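(* Let $\mathcal{D}=\{(\Sigma_k,L_k,G_k)\}_{k}$ be a treelike decomposition class of complexity $f:\mathbb{N}\to\mathbb{N}$ and arity $r$, and let $C$ be a finite, internally polynomial, $\mathcal{D}$-coherent treelike DP-core. Then one can determine whether $P(\mathcal{D}_k)\subseteq P(C,\mathcal{D})$ in time $$f(k)^{O(r)}\cdot 2^{O(r\cdot\beta_C(k)\cdot\mu_C(k))}\le f(k)^{O(r)}\cdot 2^{r\cdot 2^{O(\beta_C(k))}}.$$
   Context: Graphs: triples $G=(V,E,I)$ with $V,E$ finite subsets of $\mathbb{N}$, $I\subseteq E\times V$; $\simeq$ is isomorphism; graph properties are isomorphism-closed sets of graphs; the isomorphism closure of a set of graphs is the set of graphs isomorphic to one of its members. Terms over a ranked alphabet: finite rooted ordered labelled trees (arity = number of children); $|\tau|$ = number of nodes. Treelike decomposition class of arity $r$: $\mathcal{D}=\{(\Sigma_k,L_k,G_k)\}_{k\in\mathbb{N}}$, $\Sigma_k$ ranked alphabet of arity $\le r$, $L_k$ regular tree language over $\Sigma_k$, $G_k:L_k\to$ graphs, $\Sigma_k\subseteq\Sigma_{k+1}$, $L_k\subseteq L_{k+1}$, $G_{k+1}|_{L_k}=G_k$; $G(\tau)=G_k(\tau)$; $P(\mathcal{D}_k)$ is the isomorphism closure of $\{G(\tau):\tau\in L_k\}$. $\mathcal{D}$ has complexity $f$ if there are tree automata $A_k$ with language $L_k$ and at most $f(k)$ states, constructible from $k$ in time $k^{O(1)}f(k)^{O(r)}$. Treelike DP-core $C=\{C[k]\}$,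 $C[k]=(\Sigma_k,W_k,F_k,T_k,\mathrm{Clean}_k,\mathrm{Inv}_k)$: $W_k\subseteq\{0,1\}^*$ decidable; $F_k:W_k\to\{0,1\}$ (final witnesses); a finite $\hat a\subseteq W_k$ for each arity-$0$ symbol $a$ and a function $\hat a:W_k^p\to$ finite subsets of $W_k$ for each symbol of arity $p\ge1$; $\mathrm{Clean}_k$ finite subsets $\to$ finite subsets; $\mathrm{Inv}_k$ finite subsets $\to\{0,1\}^*$. $\hat a(S_1,\dots,S_p)=\mathrm{Clean}_k(\bigcup_{w_i\in S_i}\hat a(w_1,\dots,w_p))$. $\mathrm{Dyn}_k(a)=\hat a$ (arity $0$), $\mathrm{Dyn}_k(a(\tau_1,\dots,\tau_p))=\hat a(\mathrm{Dyn}_k(\tau_1),\dots,\mathrm{Dyn}_k(\tau_p))$; $\tau$ accepted by $C[k]$ iff $\mathrm{Dyn}_k(\tau)$ contains a final witness. $P(C,\mathcal{D})$ = isomorphism closure of $\{G(\tau):\tau\in L_k$ accepted by $C[k]$, some $k\}$. $\mathcal{D}$-coherent: the alphabets of $C$ are the $\Sigma_k$, and for $\tau\in L_k,\tau'\in L_{k'}$ with $G(\tau)\simeq G(\tau')$, $\tau$ accepted by $C[k]$ iff $\tau'$ accepted by $C[k']$, and $\mathrm{Inv}_k(\mathrm{Dyn}_k(\tau))=\mathrm{Inv}_{k'}(\mathrm{Dyn}_{k'}(\tau'))$. Measures: $S$ is $(C,k,n)$-useful if $S=\mathrm{Dyn}_k(\tau)$ for some term $\tau$ over $\Sigma_k$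 with $|\tau|\le n$; $\beta_C(k,n)$ = max bit-length of a witness in a useful set; $\mu_C(k,n)$ = max size of a useful set. $C$ is finite if $\beta_C(k,n)\le g(k)$ for some $g$ and all $n$; then $\beta_C(k)$, $\mu_C(k)$ denote the ($n$-independent) values. Internally polynomial: (1) $|\mathrm{Inv}_k(S)|=\beta_C(k,n)^{O(1)}$ for useful $S$; (2) a deterministic algorithm decides $w\in W_k$ in time $(k+|w|)^{O(1)}$, constructs arity-$0$ sets $\hat a$ in time $\beta_C(k,0)\mu_C(k,0)$, and computes $\hat a(X)$, $F_k(X)$, $\mathrm{Clean}_k(X)$, $\mathrm{Inv}_k(X)$ in time $(k+|X|)^{O(1)}$.
   Formalization: The algorithm uniform in D and C has an extra factor k^{O(1)}; without it the bound holds only with program and constants depending on D and C. Arity-0 sets are built in time polynomial in k, the symbol and β(k,1)μ(k,1), as β(k,0)μ(k,0)=0; parameters in O(.) and f(k) count as at least 1. *)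

(* Defs.v *)
From mathcomp Require Import all_boot finmap.
From Stdlib Require ClassicalEpsilon.

Set Implicit Arguments.
Unset Strict Implicit.
Unset Printing Implicit Defensive.

Local Open Scope fset_scope.

(** * Graphs *)

Record graph := Graph {
  vertices : {fset nat};
  edges : {fset nat};
  incidence : {fset nat * nat};
  incidenceP : forall ev, ev \in incidence ->
    (ev.1 \in edges) && (ev.2 \in vertices)
}.

Definition isomorphic (g h : graph) : Prop :=
  exists phi psi : nat -> nat,
    [/\ {in vertices g &, injective phi},
        phi @` vertices g = vertices h,
        {in edges g &, injective psi},
        psi @` edges g = edges h &
        forall e v, e \in edges g -> v \in vertices g ->
          ((e, v) \in incidence g) = ((psi e, phi v) \in incidence h)].

(** * Terms and tree automata *)

(* A symbol carries its own arity, so a ranked alphabet is a finite set of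
   symbols and inclusion of alphabets preserves arities. *)
Definition symbol : Type := (seq bool * nat)%type.
Definition arity (a : symbol) : nat := a.2.

Inductive term := Term of symbol & seq term.

Fixpoint term_over (Sg : {fset symbol}) (tau : term) : bool :=
  let: Term a ts := tau in
  [&& a \in Sg, size ts == arity a & all (term_over Sg) ts].

Fixpoint nodes (tau : term) : nat :=
  let: Term _ ts := tau in (sumn (map nodes ts)).+1.

(* Bottom-up nondeterministic automata; the states are 0, ..., nstates - 1 and
   ((a, [:: q_1; ...; q_p]), q) is the transition a(q_1, ..., q_p) -> q. *)
Record automaton := Automaton {
  nstates : nat;
  transitions : seq (symbol * seq nat * nat);
  finals : seq nat
}.

Definition automaton_over (Sg : {fset symbol}) (A : automaton) : bool :=
  all (fun d => [&& d.1.1 \in Sg, size d.1.2 == arity d.1.1,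
                    all (fun q => q < nstates A) d.1.2 & d.2 < nstates A])
      (transitions A)
  && all (fun q => q < nstates A) (finals A).

Fixpoint reached (A : automaton) (tau : term) : seq nat :=
  let: Term a ts := tau in
  [seq d.2 | d <- transitions A
           & (d.1.1 == a) &&
             all2 (fun q (Q : seq nat) => q \in Q) d.1.2
                  [seq reached A t | t <- ts]].

Definition recognizes (A : automaton) (tau : term) : bool :=
  has (fun q => q \in finals A) (reached A tau).

Definition language_of (Sg : {fset symbol}) (A : automaton)
    (L : term -> Prop) : Prop :=
  automaton_over Sg A /\ forall tau, L tau <-> recognizes A tau.

(** * Treelike decomposition classes *)

(* The value of [dgraph k] outside of [lang k] is irrelevant. *)
Record decomposition_class (r : nat) := DecompositionClass {
  alphabet : nat -> {fset symbol};
  lang : nat -> term -> Prop;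
  dgraph : nat -> term -> graph;
  alphabet_arity : forall k a, a \in alphabet k -> arity a <= r;
  lang_regular : forall k, exists A, language_of (alphabet k) A (lang k);
  alphabet_mono : forall k, alphabet k `<=` alphabet k.+1;
  lang_mono : forall k tau, lang k tau -> lang k.+1 tau;
  dgraph_compat : forall k tau, lang k tau -> dgraph k.+1 tau = dgraph k tau
}.

Definition class_property r (D : decomposition_class r) (k : nat) (g : graph)
    : Prop :=
  exists2 tau, lang D k tau & isomorphic (dgraph D k tau) g.

(** * Treelike DP-cores *)

Definition witness : Type := seq bool.

Record dp_core := DPCore {
  core_alphabet : nat -> {fset symbol};
  wit : nat -> pred witness;
  fin : nat -> pred witness;
  base : nat -> symbol -> {fset witness};
  step : nat -> symbol -> seq witness -> {fset witness};
  clean : nat -> {fset witness} -> {fset witness};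
  inv : nat -> {fset witness} -> seq bool;
  base_wit : forall k a, a \in core_alphabet k -> arity a = 0 ->
    {subset base k a <= wit k};
  step_wit : forall k a ws, a \in core_alphabet k -> 0 < arity a ->
    size ws = arity a -> all (wit k) ws -> {subset step k a ws <= wit k};
  clean_wit : forall k (S : {fset witness}),
    {subset S <= wit k} -> {subset clean k S <= wit k}
}.

Fixpoint choices (Ss : seq {fset witness}) : seq (seq witness) :=
  if Ss is U :: Ss' then
    [seq w :: ws | w <- enum_fset U, ws <- choices Ss']
  else [:: [::]].

Definition step_set (C : dp_core) (k : nat) (a : symbol)
    (Ss : seq {fset witness}) : {fset witness} :=
  clean C k (\bigcup_(ws <- choices Ss) step C k a ws).

Fixpoint dyn (C : dp_core) (k : nat) (tau : term) : {fset witness} :=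
  let: Term a ts := tau in
  if arity a == 0 then base C k a
  else step_set C k a [seq dyn C k t | t <- ts].

Definition accepted (C : dp_core) (k : nat) (tau : term) : Prop :=
  exists2 w, w \in dyn C k tau & fin C k w.

Definition core_property (C : dp_core) r (D : decomposition_class r)
    (g : graph) : Prop :=
  exists k tau,
    [/\ lang D k tau, accepted C k tau & isomorphic (dgraph D k tau) g].

Definition coherent r (D : decomposition_class r) (C : dp_core) : Prop :=
  (forall k, core_alphabet C k = alphabet D k) /\
  forall k k' tau tau', lang D k tau -> lang D k' tau' ->
    isomorphic (dgraph D k tau) (dgraph D k' tau') ->
    (accepted C k tau <-> accepted C k' tau') /\
    inv C k (dyn C k tau) = inv C k' (dyn C k' tau').

(** * Measures *)

Definition useful (C : dp_core) (k n : nat) (S : {fset witness}) : Prop :=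
  exists tau, [/\ term_over (core_alphabet C k) tau, nodes tau <= n
                & S = dyn C k tau].

(* The maximum of a bounded set of natural numbers, 0 for the empty set;
   unspecified for an unbounded set. *)
Definition maximum (A : nat -> Prop) : nat :=
  ClassicalEpsilon.epsilon (inhabits 0) (fun m =>
    (forall a, A a -> a <= m) /\
    (forall m', (forall a, A a -> a <= m') -> m <= m')).

Definition beta (C : dp_core) (k n : nat) : nat :=
  maximum (fun b => exists S w, [/\ useful C k n S, w \in S & b = size w]).

Definition mu (C : dp_core) (k n : nat) : nat :=
  maximum (fun m => exists2 S, useful C k n S & m = #|` S|).

Definition finite_core (C : dp_core) : Prop :=
  exists g : nat -> nat, forall k n, beta C k n <= g k.

(* The n-independent measures; meaningful for finite cores. *)
Definition betaK (C : dp_core) (k : nat) : nat :=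
  maximum (fun b => exists n, b = beta C k n).

Definition muK (C : dp_core) (k : nat) : nat :=
  maximum (fun m => exists n, m = mu C k n).

(** * Computation *)

(* First-order recursive programs over binary trees.  Building a pair costs
   the size of that pair and every other evaluation step costs one unit, so
   that a value computed in time t either occurs inside the data at hand or
   has size at most t; running times are therefore polynomially related to
   those of Turing machines. *)
Inductive tree := Leaf | Node of tree & tree.

Fixpoint tree_size (x : tree) : nat :=
  if x is Node y z then (tree_size y + tree_size z).+1 else 1.

Definition hd (x : tree) : tree := if x is Node y _ then y else Leaf.
Definition tl (x : tree) : tree := if x is Node _ z then z else Leaf.

(* [E] names the external subroutines.  [EVar i] is a de Bruijn index. *)
Inductive expr (E : Type) :=
| EVar of nat
| ENil
| EPair of expr E & expr E
| EHd of expr E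
| ETl of expr E
| EIf of expr E & expr E & expr E
| ELet of expr E & expr E
| ECall of nat & expr E
| EExt of E & expr E.
Arguments EVar {E} _.
Arguments ENil {E}.

(* The i-th entry is the body of the i-th function, with its argument as
   [EVar 0]; execution starts in function 0. *)
Definition program (E : Type) : Type := seq (expr E).

(* [X e x y t]: on argument x, the subroutine e returns y in time t. *)
Inductive eval (E : Type) (X : E -> tree -> tree -> nat -> Prop)
    (p : program E) : seq tree -> expr E -> tree -> nat -> Prop :=
| EvVar rho i : eval X p rho (EVar i) (nth Leaf rho i) 1
| EvNil rho : eval X p rho ENil Leaf 1
| EvPair rho e1 e2 v1 v2 t1 t2 :
    eval X p rho e1 v1 t1 -> eval X p rho e2 v2 t2 ->
    eval X p rho (EPair e1 e2) (Node v1 v2) (t1 + t2 + tree_size (Node v1 v2))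
| EvHd rho e v t : eval X p rho e v t -> eval X p rho (EHd e) (hd v) t.+1
| EvTl rho e v t : eval X p rho e v t -> eval X p rho (ETl e) (tl v) t.+1
| EvIfNode rho e e1 e2 v1 v2 v t t' :
    eval X p rho e (Node v1 v2) t -> eval X p rho e1 v t' ->
    eval X p rho (EIf e e1 e2) v (t + t').+1
| EvIfLeaf rho e e1 e2 v t t' :
    eval X p rho e Leaf t -> eval X p rho e2 v t' ->
    eval X p rho (EIf e e1 e2) v (t + t').+1
| EvLet rho e1 e2 v1 v t t' :
    eval X p rho e1 v1 t -> eval X p (v1 :: rho) e2 v t' ->
    eval X p rho (ELet e1 e2) v (t + t').+1
| EvCall rho i e v1 v t t' :
    eval X p rho e v1 t -> eval X p [:: v1] (nth ENil p i) v t' ->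
    eval X p rho (ECall i e) v (t + t').+1
| EvExt rho q e v1 v t t' :
    eval X p rho e v1 t -> X q v1 v t' ->
    eval X p rho (EExt q e) v (t + t').+1.

Definition runs (E : Type) (X : E -> tree -> tree -> nat -> Prop)
    (p : program E) (x y : tree) (t : nat) : Prop :=
  eval X p [:: x] (nth ENil p 0) y t.

Definition no_ext (e : void) (x y : tree) (t : nat) : Prop := False.

(* The running time of a subroutine is charged to its caller. *)
Definition link (E : Type) (impl : E -> program void)
    (e : E) (x y : tree) (t : nat) : Prop :=
  runs no_ext (impl e) x y t.

Definition computes (E : Type) (X : E -> tree -> tree -> nat -> Prop)
    (p : program E) (x : tree) (out : tree -> Prop) (T : nat) : Prop :=
  exists y t, [/\ out y, t <= T & runs X p x y t].

(** * Encodings *)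

Definition enc_seq (A : Type) (enc : A -> tree) (s : seq A) : tree :=
  foldr (fun a x => Node (enc a) x) Leaf s.

Definition enc_bool (b : bool) : tree := if b then Node Leaf Leaf else Leaf.
Definition enc_nat (n : nat) : tree := enc_seq (fun x : tree => x) (nseq n Leaf).
Definition enc_str (w : seq bool) : tree := enc_seq enc_bool w.
Definition enc_symbol (a : symbol) : tree := Node (enc_str a.1) (enc_nat a.2).
Definition enc_automaton (A : automaton) : tree :=
  Node (enc_nat (nstates A))
    (Node (enc_seq (fun d => Node (enc_symbol d.1.1)
                         (Node (enc_seq enc_nat d.1.2) (enc_nat d.2)))
             (transitions A))
          (enc_seq enc_nat (finals A))).

(* A finite set is represented by any duplicate-free list of its elements. *)
Definition codes_set (S : {fset witness}) (x : tree) : Prop :=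
  exists s : seq witness, [/\ uniq s, s =i S & x = enc_seq enc_str s].

(** * Effectiveness hypotheses *)

(* n^O(1) is read as c n^c + c, with c the hidden constant. *)
Definition poly (c n : nat) : nat := c * n ^ c + c.

(* Parameters occurring inside O(.) or below an O(.) exponent are read as at
   least 1. *)
Definition pos (n : nat) : nat := maxn 1 n.

Inductive routine :=
  RAutomaton | RWit | RBase | RStep | RFin | RClean | RInv.

Definition has_complexity (c : nat) r (D : decomposition_class r)
    (f : nat -> nat) (p : program void) : Prop :=
  forall k, exists A,
    [/\ language_of (alphabet D k) A (lang D k),
        nstates A <= f k &
        computes no_ext p (enc_nat k) (eq (enc_automaton A))
          (poly c k * pos (f k) ^ (c * pos r))].

(* Inputs include k in unary, so that their size is linear in k + |X|. For a
   symbol of arity 0 the budget is governed by the measures for one-node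
   terms, the smallest ones. *)
Definition internally_polynomial (c : nat) (C : dp_core)
    (impl : routine -> program void) : Prop :=
  let ptime q x out := computes no_ext (impl q) x out (poly c (tree_size x)) in
  (forall k n S, useful C k n S -> size (inv C k S) <= poly c (beta C k n)) /\
  [/\ forall k w, ptime RWit (Node (enc_nat k) (enc_str w))
        (eq (enc_bool (wit C k w))),
      forall k a, a \in core_alphabet C k -> arity a = 0 ->
        let x := Node (enc_nat k) (enc_symbol a) in
        computes no_ext (impl RBase) x (codes_set (base C k a))
          (poly c (tree_size x + beta C k 1 * mu C k 1)),
      forall k a ws, a \in core_alphabet C k -> 0 < arity a ->
        size ws = arity a -> all (wit C k) ws ->
        ptime RStep
          (Node (enc_nat k) (Node (enc_symbol a) (enc_seq enc_str ws)))
          (codes_set (step C k a ws)),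
      forall k w, wit C k w ->
        ptime RFin (Node (enc_nat k) (enc_str w)) (eq (enc_bool (fin C k w))) &
      forall k (S : {fset witness}) x, {subset S <= wit C k} -> codes_set S x ->
        ptime RClean (Node (enc_nat k) x) (codes_set (clean C k S)) /\
        ptime RInv (Node (enc_nat k) x) (eq (enc_str (inv C k S)))].

(** * The decision problem and its time bounds *)

Definition included r (D : decomposition_class r) (C : dp_core) (k : nat)
    : Prop :=
  forall g, class_property D k g -> core_property C D g.

Definition decides (E : Type) (X : E -> tree -> tree -> nat -> Prop)
    (p : program E) (Q : nat -> Prop) (T : nat -> nat) : Prop :=
  forall k, exists2 b : bool, b <-> Q k &
    computes X p (enc_nat k) (eq (enc_bool b)) (T k).

(* f(k)^(c r) * 2^(c r beta mu) *)
Definition time_bound (c r : nat) (f : nat -> nat) (C : dp_core) (k : nat)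
    : nat :=
  pos (f k) ^ (c * pos r) * 2 ^ (c * (pos r * pos (betaK C k) * pos (muK C k))).

(* f(k)^(c r) * 2^(r 2^(c beta)) *)
Definition coarse_bound (c r : nat) (f : nat -> nat) (C : dp_core) (k : nat)
    : nat :=
  pos (f k) ^ (c * pos r) * 2 ^ (pos r * 2 ^ (c * pos (betaK C k))).

(* Main.v *)
(**
Coherence makes the inclusion equivalent to "C[k] accepts every term of L_k":
a graph in P(D_k) that also lies in P(C, D) is the image of an accepted term,
and acceptance is invariant under isomorphism of the images.  To decide this,
saturate the set of pairs (q, Dyn_k(tau)) with q a state reached by the tree
automaton on tau: apply every transition to every tuple of known pairs until
nothing new appears, and then test every pair with an accepting state for a
final witness.  There are at most f(k) 2^((beta + 1) mu) pairs, hence at most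
f(k)^r 2^(2 r beta mu) tuples per transition, and all remaining quantities are
polynomial in these numbers, in k and in the size of the automaton.

The bound without a factor polynomial in k holds for a cheap reason: the
inclusion is antitone in k, so for a fixed class and core it is decided by one
comparison of k with a constant.
*)

Require Import Defs.
From HB Require Import structures.
From mathcomp Require Import all_boot finmap zify.
From Stdlib Require ClassicalEpsilon.

Set Implicit Arguments.
Unset Strict Implicit.
Unset Printing Implicit Defensive.

(** * The inclusion in terms of accepted terms *)

(** All costs are measured against one number [B] that bounds the size of every value occurring in a
    run: each function of the program takes time polynomial in [B], and [B] is polynomial in
    [M = (k + 2) f(k)^r 2^(r beta mu)], so the total is a power of [M] whose exponent depends on the
    hidden constant of the hypotheses only. Building a pair costs its size, hence size bounds for
    all intermediate values have to be carried along with correctness.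

    The obstacle is that the routines of the core promise nothing outside their domain and return a
    set as some list in an unknown order. Therefore every stored pair comes with a term that
    produces it: this keeps all arguments inside the witness sets and makes the measures of the core
    applicable. Sets are compared by mutual inclusion, and the specifications of the functions are
    relations rather than equations wherever a set is involved. *)

Lemma isomorphic_refl g : isomorphic g g.
Proof. by exists id, id; split=> //; rewrite imfset_id. Qed.

Section Inclusion.
Variables (r : nat) (D : decomposition_class r) (C : dp_core).
Hypothesis coh : coherent D C.

Lemma includedE k :
  included D C k <-> forall tau, lang D k tau -> accepted C k tau.
Proof.
have [_ cohD] := coh; split=> [inc tau Ltau | acc g [tau Ltau iso]].
  have [] := inc (dgraph D k tau).
    by exists tau => //; apply: isomorphic_refl.
  by move=> k' [tau' [Ltau' acc' /(cohD _ _ _ _ Ltau' Ltau) [[]]]]; auto.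
by exists k, tau; split=> //; apply: acc.
Qed.

Lemma lang_leq k k' tau : k <= k' -> lang D k tau ->
  lang D k' tau /\ dgraph D k' tau = dgraph D k tau.
Proof.
move/subnK <-; elim: (k' - k) => [|n IHn] //= /[dup] Ltau /IHn[Ln <-].
by rewrite addSn; split; [apply: lang_mono | apply: dgraph_compat].
Qed.

Lemma included_anti k k' : k <= k' -> included D C k' -> included D C k.
Proof.
move=> lekk' /includedE inc; apply/includedE => tau Ltau.
have [Ltau' eqG] := lang_leq lekk' Ltau.
have [_ /(_ k k' tau tau Ltau Ltau')] := coh.
rewrite eqG => /(_ (isomorphic_refl _))[[_ acc] _].
by apply: acc; apply: inc.
Qed.

(** A downward closed set of numbers is everything or an initial segment. The case distinction is
    classical and gives no method to find the threshold. *)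
Lemma included_threshold :
  (forall k, included D C k) \/ exists n, forall k, included D C k <-> k < n.
Proof.
pose b k : bool := ClassicalEpsilon.excluded_middle_informative (included D C k).
have bP k : reflect (included D C k) (b k).
  by rewrite /b; case: ClassicalEpsilon.excluded_middle_informative => h; constructor.
case: (ClassicalEpsilon.excluded_middle_informative (exists k, ~~ b k)) => [ex|nex].
  right; exists (ex_minn ex); case: ex_minnP => m /bP ninc minm k; split=> [inc|].
    rewrite ltnNge; apply/negP => lemk; apply: ninc.
    exact: included_anti lemk inc.
  move=> ltkm; apply/bP; apply: contraLR ltkm => /minm; lia.
by left=> k; apply/bP/negPn/negP => nb; apply: nex; exists k.
Qed.

(** Any constant is absorbed by the power of two, as [c <= 2 ^ c] and the remaining factors of the
    exponent are positive. *)
Lemma time_bound_ge c f k : c <= time_bound c r f C k.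
Proof.
rewrite /time_bound -[leqLHS]mul1n leq_mul ?expn_gt0 /pos ?leq_max //.
apply: leq_trans (ltnW (ltn_expl c (ltnSn 1))) _.
by rewrite leq_exp2l // leq_pmulr // !muln_gt0 !leq_max.
Qed.

Lemma eval_iter_tl E X (p : program E) n x :
  eval X p [:: x] (iter n (@ETl E) (EVar 0)) (iter n tl x) n.+1.
Proof. by elim: n => [|n IHn] /=; constructor. Qed.

Lemma iter_tl_enc_nat n k : iter n tl (enc_nat k) = enc_nat (k - n).
Proof.
elim: n => [|n IHn]; first by rewrite subn0.
by rewrite iterS IHn subnS; case: (k - n).
Qed.

(* The inclusion holds for all [k] or exactly below a threshold, so that
   constant time suffices once the class and the core are fixed. *)
Lemma decides_included f : exists (Q : program void) (c : nat),
  decides no_ext Q (included D C) (time_bound c r f C).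
Proof.
pose tt_ : expr void := EPair ENil ENil.
have evtt rho p : eval no_ext p rho tt_ (enc_bool true) 5.
  exact: (EvPair (EvNil _ _ _) (EvNil _ _ _)).
case: included_threshold => [all_inc|[[|n] thr]].
- exists [:: tt_], 5 => k; exists true => //.
  by exists (enc_bool true), 5; split=> //; apply: time_bound_ge.
- exists [:: ENil], 1 => k; exists false; first by rewrite thr.
  by exists Leaf, 1; split; rewrite ?time_bound_ge //; apply: EvNil.
(* Numbers are unary, so the [n]-th tail of the code of [k] is a leaf exactly when [k < n.+1]. *)
- exists [:: EIf (iter n (@ETl _) (EVar 0)) ENil tt_], (n + 10) => k.
  exists (k < n.+1); first by rewrite thr.
  set p := [:: _].
  have ev := eval_iter_tl no_ext p n (enc_nat k).
  rewrite iter_tl_enc_nat in ev.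
  case: ltnP => lekn.
    exists (enc_bool true), (n.+1 + 5).+1; split=> //.
      by apply: leq_trans (time_bound_ge _ _ _); lia.
    by apply: EvIfLeaf (evtt _ _); move: ev; have /eqP-> : k - n == 0 by lia.
  exists Leaf, (n.+1 + 1).+1; split=> //.
    by apply: leq_trans (time_bound_ge _ _ _); lia.
  move: ev; have -> : k - n = (k - n).-1.+1 by lia.
  by move/EvIfNode; apply; apply: EvNil.
Qed.

End Inclusion.

(** * Measures *)

(** The epsilon in [maximum] has a meaning only if a least upper bound exists; it is found as the
    least element of the nonempty set of upper bounds. *)
Lemma maximumP (A : nat -> Prop) : (exists m, forall a, A a -> a <= m) ->
  (forall a, A a -> a <= maximum A) /\
  (forall m, (forall a, A a -> a <= m) -> maximum A <= m).
Proof.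
move=> exA; apply: (ClassicalEpsilon.epsilon_spec (inhabits 0) (fun m =>
  (forall a, A a -> a <= m) /\ (forall m', (forall a, A a -> a <= m') -> m <= m'))).
pose b m : bool :=
  ClassicalEpsilon.excluded_middle_informative (forall a, A a -> a <= m).
have bP m : reflect (forall a, A a -> a <= m) (b m).
  by rewrite /b; case: ClassicalEpsilon.excluded_middle_informative => h; constructor.
have exb : exists m, b m by have [m /bP] := exA; exists m.
have [m /bP Am minm] := ex_minnP exb; exists m; split=> // m' /bP.
exact: minm.
Qed.

Lemma leq_maximum (A : nat -> Prop) m a :
  (forall a, A a -> a <= m) -> A a -> a <= maximum A.
Proof. by move=> Am; have [|+ _] := @maximumP A; [exists m | apply]. Qed.

Lemma maximum_leq (A : nat -> Prop) m :
  (forall a, A a -> a <= m) -> maximum A <= m.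
Proof. by move=> Am; have [|_ +] := @maximumP A; [exists m | apply]. Qed.

Lemma in_choices Ss ws :
  (ws \in choices Ss) = all2 (fun w (U : {fset witness}) => w \in U) ws Ss.
Proof.
elim: Ss ws => [|U Ss IHSs] [|w ws] //=.
  by apply/negbTE/allpairsP => -[? []].
apply/allpairsP/andP => [[[w' ws'] /= [Uw' + [-> ->]]]|[Uw Sws]].
  by rewrite IHSs.
by exists (w, ws); rewrite /= IHSs.
Qed.

(** Terms are nested through [seq], and the generated induction principle gives no hypothesis for
    the children. *)
Lemma term_all_ind (Q : term -> Prop) :
  (forall a ts, (forall t, List.In t ts -> Q t) -> Q (Term a ts)) ->
  forall t, Q t.
Proof.
move=> IH; fix F 1 => -[a ts]; apply: IH.
elim: ts => [|t ts IHts] t' /=; first by case.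
case=> [<-|]; [exact: F | exact: IHts].
Qed.

(** One enumeration serves three counts: bit strings, tuples of useful sets, and padded sets of
    witnesses. *)
Definition words (T : Type) (s : seq T) (n : nat) : seq (seq T) :=
  iter n (fun ws => [seq x :: w | x <- s, w <- ws]) [:: [::]].

Lemma size_words (T : Type) (s : seq T) n : size (words s n) = size s ^ n.
Proof. by elim: n => //= n IHn; rewrite size_allpairs IHn expnS. Qed.

Lemma mem_words (T : eqType) (s : seq T) n w :
  (w \in words s n) = (size w == n) && all (mem s) w.
Proof.
elim: n w => [|n IHn] [|x w] //=; first by apply/negbTE/allpairsP => -[? []].
rewrite eqSS; apply/allpairsP/and3P => [[[y v] /= [sy + [-> ->]]]|[szw sx sw]].
  by rewrite IHn => /andP[].
by exists (x, w); rewrite /= IHn szw.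
Qed.

Definition strings (b : nat) : seq witness :=
  flatten [seq words [:: true; false] i | i <- iota 0 b.+1].

Lemma mem_strings b w : size w <= b -> w \in strings b.
Proof.
move=> lewb; apply/flatten_mapP; exists (size w).
  by rewrite mem_iota add0n ltnS.
by rewrite mem_words eqxx; apply/allP => -[] _.
Qed.

Lemma size_strings b : size (strings b) < 2 ^ b.+1.
Proof.
rewrite /strings; elim: b => [|b IHb] //.
rewrite -[X in iota 0 X]addn1 iotaD map_cat flatten_cat size_cat.
rewrite [flatten [seq _ | i <- iota (0 + _) 1]]cats0 size_words add0n.
by move: IHb; rewrite !expnS [size _]/=; lia.
Qed.

Section Measures.
Variable (C : dp_core).
Hypothesis finC : finite_core C.
Variable k : nat.
Let Sg := core_alphabet C k.

(** The alphabet is finite and children have fewer nodes than their parent. This makes the maxima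
    defining [beta] and [mu] exist for each fixed [n]. *)
Lemma useful_finite n : exists Us : seq {fset witness},
  forall tau, term_over Sg tau -> nodes tau <= n -> dyn C k tau \in Us.
Proof.
elim: n => [|n [Us IHn]]; first by exists [::] => -[].
exists (flatten [seq base C k a ::
  [seq step_set C k a Ss | Ss <- words Us (arity a)] | a <- Sg]).
case=> a ts /= /and3P[Sa szts Sts] lets.
apply/flatten_mapP; exists a => //; rewrite inE.
case: ifP => _; rewrite ?eqxx //; apply/orP; right; apply/map_f.
rewrite mem_words size_map szts /=.
elim: ts {szts} Sts lets => //= t ts IHts /andP[St Sts] lets.
by rewrite IHn ?IHts //; lia.
Qed.

Lemma useful_bounded n : exists m, forall S, useful C k n S ->
  #|` S| <= m /\ forall w, w \in S -> size w <= m.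
Proof.
have [Us UsP] := useful_finite n.
exists (\sum_(S <- Us) (#|` S| + \sum_(w <- S) size w)) => S [tau [St len ->]].
rewrite (big_rem _ (UsP _ St len)) /=; split=> [|w Sw]; first lia.
by rewrite (big_rem _ Sw) /=; lia.
Qed.

Lemma useful_size n S : useful C k n S ->
  #|` S| <= mu C k n /\ forall w, w \in S -> size w <= beta C k n.
Proof.
move=> uS; have [m mP] := useful_bounded n; split=> [|w Sw].
  by apply: (@leq_maximum _ m) => [_ [U /mP[] ? _ ->]|] //; exists S.
apply: (@leq_maximum _ m) => [_ [U [v [/mP[] _ + Uv ->]]]|]; first exact.
by exists S, w.
Qed.

Lemma beta_betaK n : beta C k n <= betaK C k.
Proof.
have [g gP] := finC; apply: (@leq_maximum _ (g k)); last by exists n.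
by move=> _ [m ->].
Qed.

(** A useful set consists of distinct bit strings of length at most [betaK C k]. Finiteness of the
    core bounds only witness lengths; this bound is what makes [muK] a genuine maximum as well. *)
Lemma mu_exp n : mu C k n <= 2 ^ (betaK C k).+1.
Proof.
apply: maximum_leq => _ [S /useful_size[_ szS] ->].
apply: leq_trans (ltnW (size_strings _)).
apply: uniq_leq_size (fset_uniq _) _ => w Sw.
by apply: mem_strings; apply: leq_trans (szS w Sw) (beta_betaK n).
Qed.

Lemma mu_muK n : mu C k n <= muK C k.
Proof.
apply: (@leq_maximum _ (2 ^ (betaK C k).+1)); last by exists n.
by move=> _ [m ->]; apply: mu_exp.
Qed.

Lemma muK_exp : muK C k <= 2 ^ (betaK C k).+1.
Proof. by apply: maximum_leq => _ [n ->]; apply: mu_exp. Qed.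

Lemma dyn_size tau : term_over Sg tau ->
  #|` dyn C k tau| <= muK C k /\
  forall w, w \in dyn C k tau -> size w <= betaK C k.
Proof.
move=> St; have [|szS szw] := @useful_size (nodes tau) (dyn C k tau).
  by exists tau.
split=> [|w /szw]; first exact: leq_trans szS (mu_muK _).
by move/leq_trans; apply; apply: beta_betaK.
Qed.

(** Needed because the routines of the core are specified on members of [wit C k] only. *)
Lemma dyn_wit tau : term_over Sg tau -> {subset dyn C k tau <= wit C k}.
Proof.
elim/term_all_ind: tau => a ts IHts /= /and3P[Sa /eqP szts Sts].
case: eqP => [a0|/eqP]; first exact: base_wit.
rewrite -lt0n => a_gt0; apply: clean_wit => w /bigfcupP[ws].
rewrite andbT in_choices => wsP; apply: step_wit => //.
  by move: wsP; rewrite all2E !size_map => /andP[/eqP-> _].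
elim: ts ws {szts} IHts Sts wsP => [|t ts IH] [|v ws] //= IHts.
move=> /andP[St Sts] /andP[tv tsws].
rewrite [wit _ _ _](IHts t) ?IH //; first by move=> t' t't; apply: IHts; right.
by left.
Qed.

End Measures.

Lemma time_bound_coarse C r f a : finite_core C ->
  exists b, forall k, time_bound a r f C k <= coarse_bound b r f C k.
Proof.
(* The factors [a], [pos b] and [pos m] of the exponent are at most 2 to the powers [a * pos b],
   [pos b] and [2 * pos b], which add up to [(a + 3) * pos b]. *)
move=> finC; exists (a + 4) => k; rewrite /time_bound /coarse_bound.
have F_gt0 : 0 < pos (f k) by rewrite /pos leq_max.
apply: leq_mul.
  have [->|F_gt1] := eqVneq (pos (f k)) 1; first by rewrite !exp1n.
  by rewrite leq_exp2l ?leq_mul2r ?leq_addr ?orbT // ltn_neqAle eq_sym F_gt1.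
rewrite leq_exp2l //.
have := muK_exp finC k; set b := betaK C k; set m := muK C k => lem.
have lepm : pos m <= 2 ^ (2 * pos b).
  rewrite /pos geq_max expn_gt0 /=; apply: leq_trans lem _.
  by rewrite leq_exp2l //; lia.
have lepb : pos b <= 2 ^ pos b by apply: ltnW; apply: ltn_expl.
have lea : a <= 2 ^ (a * pos b).
  apply: leq_trans (ltnW (ltn_expl a (ltnSn 1))) _.
  by rewrite leq_exp2l // leq_pmulr // /pos leq_max.
have -> : a * (pos r * pos b * pos m) = pos r * (a * (pos b * pos m)) by lia.
rewrite leq_mul2l; apply/orP; right.
apply: leq_trans (leq_mul lea (leq_mul lepb lepm)) _.
rewrite -!expnD leq_exp2l //; lia.
Qed.

(** * Trees and running times *)

Fixpoint tree_eqb (x y : tree) : bool :=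
  match x, y with
  | Leaf, Leaf => true
  | Node x1 x2, Node y1 y2 => tree_eqb x1 y1 && tree_eqb x2 y2
  | _, _ => false
  end.

Lemma tree_eqP : Equality.axiom tree_eqb.
Proof.
elim=> [|x1 IH1 x2 IH2] [|y1 y2] /=; try by constructor.
by apply: (iffP andP) => [[/IH1-> /IH2->]|[/IH1-> /IH2->]].
Qed.

HB.instance Definition _ := hasDecEq.Build tree tree_eqP.

Definition lst (s : seq tree) : tree := foldr Node Leaf s.

Lemma enc_seqE A (enc : A -> tree) s : enc_seq enc s = lst (map enc s).
Proof. by elim: s => //= a s <-. Qed.

Lemma tree_size_gt0 x : 0 < tree_size x.
Proof. by case: x. Qed.

Lemma size_lst s : size s < tree_size (lst s).
Proof. by elim: s => //= x s; have := tree_size_gt0 x; lia. Qed.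

Lemma tree_size_cat s1 s2 :
  (tree_size (lst (s1 ++ s2))).+1 = tree_size (lst s1) + tree_size (lst s2).
Proof. by elim: s1 => //= x s1; lia. Qed.

Lemma tree_size_lst s m : (forall x, x \in s -> tree_size x <= m) ->
  tree_size (lst s) <= size s * m.+1 + 1.
Proof.
elim: s => //= x s IHs sm.
have := sm x (mem_head _ _).
have: tree_size (lst s) <= size s * m.+1 + 1.
  by apply: IHs => y sy; apply: sm; rewrite inE sy orbT.
lia.
Qed.

(** Inverse to [lst]: every tree is the code of exactly one list, so list specifications can be
    stated for arbitrary trees. *)
Fixpoint spine (t : tree) : seq tree :=
  if t is Node x u then x :: spine u else [::].

Lemma lstK : cancel lst spine.
Proof. by elim=> //= x s ->. Qed.

Lemma spineK : cancel spine lst.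
Proof. by elim=> //= x _ u ->. Qed.

Lemma tree_size_mem x s : x \in s -> tree_size x < tree_size (lst s).
Proof.
elim: s => //= y s IHs; rewrite inE => /predU1P[->|/IHs]; last by lia.
by have := tree_size_gt0 (lst s); lia.
Qed.

Lemma tree_size_rev s : tree_size (lst (rev s)) = tree_size (lst s).
Proof.
elim: s => //= x s IHs.
by rewrite rev_cons -cats1; have := tree_size_cat (rev s) [:: x]; rewrite IHs /=; lia.
Qed.

(** * A weakest-precondition calculus with running times *)

Section Wp.
Variables (E : Type) (X : E -> tree -> tree -> nat -> Prop) (p : program E).

Definition spec rho e (R : tree -> Prop) (T : nat) : Prop :=
  exists v t, [/\ eval X p rho e v t, R v & t <= T].

(* A weakest precondition; the cost passed to the postcondition is an upper
   bound, as the callees are only known through upper bounds. *)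
Fixpoint wp (rho : seq tree) (e : expr E) (K : tree -> nat -> Prop) : Prop :=
  match e with
  | EVar i => K (nth Leaf rho i) 1
  | ENil => K Leaf 1
  | EPair e1 e2 =>
      wp rho e1 (fun v1 t1 => wp rho e2 (fun v2 t2 =>
        K (Node v1 v2) (t1 + t2 + tree_size (Node v1 v2))))
  | EHd e1 => wp rho e1 (fun v t => K (hd v) t.+1)
  | ETl e1 => wp rho e1 (fun v t => K (tl v) t.+1)
  | EIf e1 e2 e3 =>
      wp rho e1 (fun v t => wp rho (if v is Node _ _ then e2 else e3)
        (fun v' t' => K v' (t + t').+1))
  | ELet e1 e2 =>
      wp rho e1 (fun v1 t1 => wp (v1 :: rho) e2 (fun v t => K v (t1 + t).+1))
  | ECall i e1 =>
      wp rho e1 (fun v t => exists R T, spec [:: v] (nth ENil p i) R T /\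
        forall v', R v' -> K v' (t + T).+1)
  | EExt q e1 =>
      wp rho e1 (fun v t => exists R T,
        (exists v' t', [/\ R v', t' <= T & X q v v' t']) /\
        forall v', R v' -> K v' (t + T).+1)
  end.

(** Structural induction on the expression is enough, because a call is entered only through a
    [spec] that already asserts termination. Recursive functions thus need an outer induction on
    their argument. *)
Lemma wp_sound rho e K : wp rho e K ->
  exists v t T, [/\ eval X p rho e v t, t <= T & K v T].
Proof.
elim: e rho K => [i||e1 IH1 e2 IH2|e IH|e IH|e1 IH1 e2 IH2 e3 IH3|e1 IH1 e2 IH2
    |i e IH|q e IH] rho K /=.
- by move=> Kv; do 3!eexists; split; [constructor| |exact: Kv].
- by move=> Kv; do 3!eexists; split; [constructor| |exact: Kv].
- case/IH1=> v1 [t1 [T1 [ev1 le1 /IH2[v2 [t2 [T2 [ev2 le2 Kv]]]]]]].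
  by do 3!eexists; split; [apply: EvPair ev1 ev2 | | exact: Kv] => /=; lia.
- case/IH=> v [t [T [ev le Kv]]].
  by do 3!eexists; split; [apply: EvHd ev | | exact: Kv] => /=; lia.
- case/IH=> v [t [T [ev le Kv]]].
  by do 3!eexists; split; [apply: EvTl ev | | exact: Kv] => /=; lia.
- case/IH1=> -[|x y] [t1 [T1 [ev1 le1]]].
    case/IH3=> v [t [T [ev le Kv]]].
    by do 3!eexists; split; [apply: EvIfLeaf ev1 ev | | exact: Kv] => /=; lia.
  case/IH2=> v [t [T [ev le Kv]]].
  by do 3!eexists; split; [apply: EvIfNode ev1 ev | | exact: Kv] => /=; lia.
- case/IH1=> v1 [t1 [T1 [ev1 le1 /IH2[v2 [t2 [T2 [ev2 le2 Kv]]]]]]].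
  by do 3!eexists; split; [apply: EvLet ev1 ev2 | | exact: Kv] => /=; lia.
- case/IH=> v [t [T [ev le [R [T' [[v' [t' [ev' Rv' le']]] /(_ v' Rv') Kv]]]]]].
  by do 3!eexists; split; [apply: EvCall ev ev' | | exact: Kv] => /=; lia.
- case/IH=> v [t [T [ev le [R [T' [[v' [t' [Rv' le' ev']]] /(_ v' Rv') Kv]]]]]].
  by do 3!eexists; split; [apply: EvExt ev ev' | | exact: Kv] => /=; lia.
Qed.

Lemma wp_mono rho e (K K' : tree -> nat -> Prop) :
  (forall v t, K v t -> K' v t) -> wp rho e K -> wp rho e K'.
Proof.
elim: e rho K K' => [i||e1 IH1 e2 IH2|e IH|e IH|e1 IH1 e2 IH2 e3 IH3|e1 IH1 e2 IH2
    |i e IH|q e IH] rho K K' KK' /=; auto.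
- by apply: IH1 => v t; apply: IH2 => v' t'; auto.
- by apply: IH => v t; auto.
- by apply: IH => v t; auto.
- by apply: IH1 => -[|x y] t; [apply: IH3 | apply: IH2] => v' t'; auto.
- by apply: IH1 => v t; apply: IH2 => v' t'; auto.
- by apply: IH => v t [R [T [sp RK]]]; exists R, T; split=> // v' /RK; auto.
- by apply: IH => v t [R [T [sp RK]]]; exists R, T; split=> // v' /RK; auto.
Qed.

Lemma wp_spec rho e R T :
  wp rho e (fun v t => R v /\ t <= T) -> spec rho e R T.
Proof.
case/wp_sound=> v [t [T' [ev le [Rv le']]]].
by exists v, t; split=> //; apply: leq_trans le'.
Qed.

Lemma spec_weaken rho e (R R' : tree -> Prop) T T' :
  spec rho e R T -> (forall v, R v -> R' v) -> T <= T' -> spec rho e R' T'.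
Proof.
case=> v [t [ev Rv le]] RR' leT.
by exists v, t; split; auto; apply: leq_trans leT.
Qed.

Definition fspec i v := spec [:: v] (nth ENil p i).

(** These accessors presuppose an argument [Node ctx (Node (Node x rest) acc)] in variable 0, so
    they must not be used below an [ELet]. *)
Definition Ctx : expr E := EHd (EVar 0).
Definition Item : expr E := EHd (EHd (ETl (EVar 0))).
Definition Acc : expr E := ETl (ETl (EVar 0)).
Definition ETrue : expr E := EPair ENil ENil.
Definition EFold i ctx s acc : expr E := ECall i (EPair ctx (EPair s acc)).

(* The body of function [i] folding the expression [G] over a list; the
   argument consists of a context, the list and the accumulator. *)
Definition loop i (G : expr E) : expr E :=
  EIf (EHd (ETl (EVar 0))) (EFold i Ctx (ETl (EHd (ETl (EVar 0)))) G) Acc.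

(** A list of size at most [B] has fewer than [B] items. Per item, the body costs [T], and the two
    nested pairs passed to the next call cost at most [5 * B] plus a constant. *)
Definition Tloop T B := B.+1 * (T + 6 * B + 30).

(** The invariant relates the processed prefix to the accumulator. It has to bound the accumulator
    by [B] as well, since each iteration pays the accumulator's size when it builds the next
    argument. *)
Lemma loop_spec i G ctx items acc0 (Inv : seq tree -> tree -> Prop) B T :
  nth ENil p i = loop i G ->
  (forall don x rest acc, don ++ x :: rest = items -> Inv don acc ->
     tree_size acc <= B ->
     wp [:: Node ctx (Node (lst (x :: rest)) acc)] G
        (fun acc' t => Inv (rcons don x) acc' /\ t <= T)) ->
  (forall don rest acc, don ++ rest = items -> Inv don acc ->
     tree_size acc <= B) ->
  tree_size ctx <= B -> tree_size (lst items) <= B -> Inv [::] acc0 ->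
  fspec i (Node ctx (Node (lst items) acc0)) (Inv items) (Tloop T B).
Proof.
move=> pi wpG accB ctxB itB Inv0.
have: forall rest don acc, don ++ rest = items -> Inv don acc ->
    fspec i (Node ctx (Node (lst rest) acc)) (Inv items)
      ((size rest).+1 * (T + 6 * B + 30)).
  elim=> [|x rest IHrest] don acc def Inva.
    rewrite cats0 in def; rewrite def in Inva.
    by rewrite /fspec pi; apply: wp_spec => /=; split=> //; lia.
  have accB' := accB _ _ _ def Inva.
  rewrite /fspec pi; apply: wp_spec => /=.
  apply: wp_mono (wpG _ _ _ _ def Inva accB') => acc' t [Inva' leT].
  have def' : rcons don x ++ rest = items by rewrite cat_rcons.
  have accB'' := accB _ _ _ def' Inva'.
  have restB : tree_size (lst rest) <= B.
    by move: itB; rewrite -def'; have := tree_size_cat (rcons don x) rest;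
       have := tree_size_gt0 (lst (rcons don x)); lia.
  do 2!eexists; split; first exact: IHrest def' Inva'.
  by move=> v Iv; split=> //; lia.
move/(_ items [::] acc0 erefl Inv0)/spec_weaken; apply=> //.
by rewrite leq_mul2r; have := size_lst items; lia.
Qed.

End Wp.
Arguments Ctx {E}.
Arguments Item {E}.
Arguments Acc {E}.
Arguments ETrue {E}.

(** * The saturation program *)

Definition v0 : expr routine := EVar 0.

Definition iEq := 1.
Definition iMem := 2.
Definition iSub := 3.
Definition iSetEq := 4.
Definition iUnion := 5.
Definition iRev := 6.
Definition iCons := 7.
Definition iExtend := 8.
Definition iChoices := 9.
Definition iStep := 10.
Definition iSet := 11.
Definition iFilter := 12.
Definition iFilters := 13.
Definition iMemX := 14.
Definition iInsert := 15.
Definition iTuples := 16.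
Definition iRound := 17.
Definition iFix := 18.
Definition iFinal := 19.
Definition iCheck := 20.

(* Lists and sets are list-shaped trees, [X] is a list of pairs (q, S), and the
   body of function [i] is the i-th entry; functions that are not loops are
   commented with their index and the shape of their argument. *)
Definition inclusion_program : program routine := [::
  (* 0: k *)
  ELet (EExt RAutomaton v0)
    (EFold iCheck (EPair (EVar 1) (ETl (ETl (EVar 0))))
      (ECall iFix (EPair (EPair (EVar 1) (EHd (ETl (EVar 0)))) ENil)) ETrue);
  (* iEq: (x, y) *)
  EIf (EHd v0)
    (EIf (ETl v0)
       (EIf (ECall iEq (EPair (EHd (EHd v0)) (EHd (ETl v0))))
          (ECall iEq (EPair (ETl (EHd v0)) (ETl (ETl v0)))) ENil)
       ENil)
    (EIf (ETl v0) ENil ETrue);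
  loop iMem (EIf (ECall iEq (EPair Ctx Item)) ETrue Acc);
  loop iSub (EIf Acc (EFold iMem Item Ctx ENil) ENil);
  (* iSetEq: (S, S') *)
  EIf (EFold iSub (ETl v0) (EHd v0) ETrue)
    (EFold iSub (EHd v0) (ETl v0) ETrue) ENil;
  loop iUnion (EIf (EFold iMem Item Acc ENil) Acc (EPair Item Acc));
  loop iRev (EPair Item Acc);
  loop iCons (EPair (EPair Ctx Item) Acc);
  loop iExtend (EFold iCons Item Ctx Acc);
  loop iChoices (EFold iExtend Acc Item ENil);
  (* context (k, a) *)
  loop iStep (EFold iUnion ENil
    (EExt RStep (EPair (EHd Ctx) (EPair (ETl Ctx) Item))) Acc);
  (* iSet: ((k, a), Ss) *)
  EIf (ETl (ETl (EHd v0)))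
    (EExt RClean (EPair (EHd (EHd v0))
      (EFold iStep (EHd v0)
        (EFold iChoices ENil (EFold iRev ENil (ETl v0) ENil) ETrue) ENil)))
    (EExt RBase (EHd v0));
  (* context q *)
  loop iFilter (EIf (ECall iEq (EPair Ctx (EHd Item))) (EPair (ETl Item) Acc) Acc);
  (* context X *)
  loop iFilters (EPair (EFold iFilter Item Ctx ENil) Acc);
  (* context (q, S) *)
  loop iMemX (EIf (ECall iEq (EPair (EHd Ctx) (EHd Item)))
    (EIf (ECall iSetEq (EPair (ETl Ctx) (ETl Item))) ETrue Acc) Acc);
  (* iInsert: ((q, S), X) *)
  EIf (EFold iMemX (EHd v0) (ETl v0) ENil) (ETl v0) v0;
  (* context ((k, a), q) *)
  loop iTuples (ECall iInsert (EPair
    (EPair (ETl Ctx) (ECall iSet (EPair (EHd Ctx) Item))) Acc));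
  (* context (k, X); item (a, (qs, q)) *)
  loop iRound (EFold iTuples
    (EPair (EPair (EHd Ctx) (EHd Item)) (ETl (ETl Item)))
    (EFold iChoices ENil (EFold iFilters (ETl Ctx) (EHd (ETl Item)) ENil) ETrue)
    Acc);
  (* iFix: ((k, transitions), X) *)
  ELet (EFold iRound (EPair (EHd (EHd v0)) (ETl v0)) (ETl (EHd v0)) (ETl v0))
    (EIf (ECall iEq (EPair (ETl (EVar 1)) (EVar 0)))
       (EVar 0) (ECall iFix (EPair (EHd (EVar 1)) (EVar 0))));
  (* context k *)
  loop iFinal (EIf Acc Acc (EExt RFin (EPair Ctx Item)));
  (* context (k, finals) *)
  loop iCheck (EIf Acc
    (EIf (EFold iMem (EHd Item) (ETl Ctx) ENil)
       (EFold iFinal (EHd Ctx) (ETl Item) ENil) ETrue) ENil)].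

Lemma tree_size_bool b : tree_size (enc_bool b) <= 3.
Proof. by case: b. Qed.

Lemma tree_size_hd x : tree_size (hd x) <= tree_size x.
Proof. by case: x => //= x y; lia. Qed.

Lemma tree_size_tl x : tree_size (tl x) <= tree_size x.
Proof. by case: x => //= x y; lia. Qed.

Definition select (q : tree) (s : seq tree) : seq tree :=
  [seq tl x | x <- s & q == hd x].

Lemma tree_size_select q s : tree_size (lst (select q s)) <= tree_size (lst s).
Proof.
elim: s => //= x s; rewrite /select /=.
by case: eqP => _ /=; have := tree_size_tl x; lia.
Qed.

(** * Specifications of the list functions *)

Section Lists.
Variable X : routine -> tree -> tree -> nat -> Prop.
Variable B : nat.
Hypothesis B_ge4 : 4 <= B.
Notation fspec := (fspec X inclusion_program).

(* [Tf B] bounds the running time of the function [if] on data of size at most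
   [B]; the constants leave room for the cost of passing arguments. *)
Definition Tcall T B := T + 30 * B + 200.
Definition Teq B := B * (4 * B + 40).
Definition Tmem B := Tloop (Tcall (Teq B) B) B.
Definition Tsub B := Tloop (Tcall (Tmem B) B) B.
Definition Tseteq B := Tcall (2 * Tsub B) B.
Definition Tunion B := Tloop (Tcall (Tmem B) B) B.
Definition Trev B := Tloop (Tcall 0 B) B.
Definition Textend B := Tloop (Tcall (Trev B) B) B.
Definition Tchoices B := Tloop (Tcall (Textend B) B) B.
Definition Tfilter B := Tloop (Tcall (Teq B) B) B.
Definition Tfilters B := Tloop (Tcall (Tfilter B) B) B.
Definition TmemX B := Tloop (Tcall (Teq B + Tseteq B) B) B.
Definition Tinsert B := Tcall (TmemX B) B.

Lemma eq_spec x y : tree_size x <= B -> tree_size y <= B ->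
  fspec iEq (Node x y) (eq (enc_bool (x == y))) (Teq B).
Proof.
(* Each node of [x] causes at most one call, and the argument pairs of its two subcalls cost up to
   [4 * B] plus a constant; the time is therefore stated in [tree_size x] for the induction. *)
move=> xB yB; have: fspec iEq (Node x y) (eq (enc_bool (x == y)))
    (tree_size x * (4 * B + 40)).
  elim: x y xB yB => [|x1 IH1 x2 IH2] [|y1 y2] /= xB yB; apply: wp_spec => /=;
    try by split=> //; lia.
  do 2!eexists; split; first by apply: IH1; lia.
  move=> _ <-; rewrite -[Node _ _ == _]/((x1 == y1) && (x2 == y2)).
  case: eqP => [_|_] /=; last by split=> //; lia.
  do 2!eexists; split; first by apply: IH2; lia.
  by move=> _ <-; split=> //; lia.
by move/spec_weaken; apply=> //; rewrite leq_mul2r xB orbT.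
Qed.

Lemma mem_spec x t : tree_size x <= B -> tree_size t <= B ->
  fspec iMem (Node x (Node t Leaf)) (eq (enc_bool (x \in spine t))) (Tmem B).
Proof.
move=> xB tB; rewrite -{1}[t]spineK.
apply: (loop_spec (Inv := fun don acc => enc_bool (x \in don) = acc)) => //.
- move=> don y rest acc def <- accB /=.
  have yB : tree_size y <= B.
    apply: leq_trans tB; rewrite -[t]spineK -def.
    by apply/ltnW/tree_size_mem; rewrite mem_cat mem_head orbT.
  do 2!eexists; split; first exact: eq_spec.
  move=> _ <-; rewrite mem_rcons inE.
  by case: eqP => _ /=; split=> //; rewrite /Tcall; lia.
- by move=> don _ acc _ <-; apply: leq_trans (tree_size_bool _) (ltnW _).
- by rewrite spineK.
Qed.

Lemma spine_size y t : y \in spine t -> tree_size y < tree_size t.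
Proof. by move/tree_size_mem; rewrite spineK. Qed.

Lemma sub_spec t u : tree_size t <= B -> tree_size u <= B ->
  fspec iSub (Node u (Node t (enc_bool true)))
    (eq (enc_bool (all (mem (spine u)) (spine t)))) (Tsub B).
Proof.
move=> tB uB; rewrite -{1}[t]spineK.
apply: (loop_spec (Inv := fun don acc =>
  enc_bool (all (mem (spine u)) don) = acc)) => //.
- move=> don y rest acc def <- accB /=; rewrite all_rcons.
  have yB : tree_size y <= B.
    apply: leq_trans tB; apply/ltnW/spine_size.
    by rewrite -def mem_cat mem_head orbT.
  case: (all _ don) => /=; last by rewrite andbF; split=> //; rewrite /Tcall; lia.
  do 2!eexists; split; first exact: mem_spec.
  by move=> _ <-; rewrite andbT; split=> //; rewrite /Tcall; lia.
- by move=> don _ acc _ <-; apply: leq_trans (tree_size_bool _) (ltnW _).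
- by rewrite spineK.
Qed.

(** Equality of sets listed in different orders; equality of trees would be too fine. *)
Definition set_eqb t u :=
  all (mem (spine u)) (spine t) && all (mem (spine t)) (spine u).

Lemma set_eqb_spec t u : tree_size t <= B -> tree_size u <= B ->
  fspec iSetEq (Node t u) (eq (enc_bool (set_eqb t u))) (Tseteq B).
Proof.
move=> tB uB; apply: wp_spec => /=.
do 2!eexists; split; first exact: sub_spec.
move=> _ <-; rewrite /set_eqb.
case: (all _ (spine t)) => /=; last by split=> //; rewrite /Tseteq /Tcall; lia.
do 2!eexists; split; first exact: sub_spec.
by move=> _ <-; split=> //; rewrite /Tseteq /Tcall; lia.
Qed.

(** An element enters the accumulator only when absent, so duplicates in [t] are dropped and a
    duplicate-free [u] yields a duplicate-free result, as a code of a set must be. *)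
Lemma union_spec t u : tree_size t + tree_size u <= B ->
  fspec iUnion (Node Leaf (Node t u)) (fun v =>
    [/\ spine v =i spine t ++ spine u, uniq (spine u) -> uniq (spine v) &
        tree_size v < tree_size t + tree_size u]) (Tunion B).
Proof.
move=> tuB; rewrite -{1}[t]spineK.
have accB don rest acc : don ++ rest = spine t ->
    tree_size acc < tree_size (lst don) + tree_size u -> tree_size acc <= B.
  move=> def; have := tree_size_cat don rest; rewrite def spineK.
  by have := tree_size_gt0 (lst rest); lia.
apply: (@spec_weaken _ _ _ _ _ (fun v =>
    [/\ spine v =i spine t ++ spine u, uniq (spine u) -> uniq (spine v) &
        tree_size v < tree_size (lst (spine t)) + tree_size u])); last first.
- exact: leqnn.
- by move=> v; rewrite spineK.
apply: (loop_spec (Inv := fun don v =>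
    [/\ spine v =i don ++ spine u, uniq (spine u) -> uniq (spine v) &
        tree_size v < tree_size (lst don) + tree_size u])) => //.
- move=> don y rest acc def [mema uacc sza] aB /=.
  have yB : tree_size y <= B.
    apply: (@leq_trans (tree_size t)); last by lia.
    by apply/ltnW/spine_size; rewrite -def mem_cat mem_head orbT.
  do 2!eexists; split; first exact: mem_spec.
  have szr : (tree_size (lst (rcons don y))) = tree_size (lst don) + tree_size y + 1.
    by rewrite -cats1; have := tree_size_cat don [:: y] => /=; lia.
  move=> _ <-; case: (boolP (y \in spine acc)) => yacc /=;
    (split; last by rewrite /Tcall; lia); split=> [x|/uacc //|]; try lia.
  + rewrite mema cat_rcons !mem_cat inE.
    by case: eqP => [->|] //=; rewrite orbT -mem_cat -mema yacc.
  + by rewrite inE mema cat_rcons !mem_cat inE orbCA.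
  + by rewrite yacc => ->.
- by move=> don rest acc def [_ _ sza]; apply: accB def sza.
- by have := tree_size_gt0 u; simpl; lia.
- by rewrite spineK; lia.
Qed.

Lemma rev_spec t : tree_size t <= B ->
  fspec iRev (Node Leaf (Node t Leaf)) (eq (lst (rev (spine t)))) (Trev B).
Proof.
move=> tB; rewrite -{1}[t]spineK.
apply: (loop_spec (Inv := fun don acc => lst (rev don) = acc)) => //.
- move=> don y rest acc def <- aB /=; rewrite rev_rcons /=; split=> //.
  have := spine_size; have := tree_size_cat don (y :: rest); rewrite def spineK /=.
  rewrite tree_size_rev /Tcall; have := tree_size_gt0 (lst rest); lia.
- move=> don rest acc def <-; rewrite tree_size_rev.
  have := tree_size_cat don rest; rewrite def spineK.
  by have := tree_size_gt0 (lst rest); lia.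
- by rewrite /=; lia.
- by rewrite spineK.
Qed.

Lemma cons_spec w (R out : seq tree) :
  tree_size (lst [seq Node w x | x <- R]) + tree_size (lst out) <= B ->
  tree_size w <= B ->
  fspec iCons (Node w (Node (lst R) (lst out)))
    (eq (lst (rev [seq Node w x | x <- R] ++ out))) (Trev B).
Proof.
move=> szB wB.
have RB : tree_size (lst R) <= B.
  suff: tree_size (lst R) <= tree_size (lst [seq Node w x | x <- R]) by lia.
  by elim: (R) => //= x s; lia.
have accB don rest : don ++ rest = R ->
    tree_size (lst (rev [seq Node w x | x <- don] ++ out)) <= B.
  move=> def; move: szB; rewrite -def map_cat.
  have := tree_size_cat [seq Node w x | x <- don] [seq Node w x | x <- rest].
  have := tree_size_cat (rev [seq Node w x | x <- don]) out.
  rewrite tree_size_rev; have := tree_size_gt0 (lst [seq Node w x | x <- rest]).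
  by lia.
apply: (loop_spec (Inv := fun don acc =>
    lst (rev [seq Node w x | x <- don] ++ out) = acc)) => //.
- move=> don y rest acc def <- aB /=; rewrite map_rcons rev_rcons /=; split=> //.
  have := accB (rcons don y) rest; rewrite cat_rcons map_rcons rev_rcons /= => /(_ def).
  by rewrite /Tcall; lia.
- by move=> don rest acc def <-; apply: accB def.
Qed.

(** One factor of a cartesian product. Only length and membership are recorded, since the order of
    the tuples is irrelevant later. *)
Lemma extend_spec (U R : seq tree) m :
  (forall w x, w \in U -> x \in R -> tree_size (Node w x) <= m) ->
  (size U * size R) * m.+1 + 2 <= B ->
  tree_size (lst R) <= B -> tree_size (lst U) <= B ->
  fspec iExtend (Node (lst R) (Node (lst U) Leaf))
    (fun v => exists Ts : seq tree, [/\ v = lst Ts, size Ts = size U * size R &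
        Ts =i [seq Node w x | w <- U, x <- R]]) (Textend B).
Proof.
move=> szm UB RB UB'.
have szT (don rest Ts : seq tree) : don ++ rest = U ->
    Ts =i [seq Node w x | w <- don, x <- R] ->
    size Ts = size don * size R -> tree_size (lst Ts) <= size don * size R * m.+1 + 1.
  move=> def memT <-; apply: tree_size_lst => y; rewrite memT.
  case/allpairsP=> -[w x] /= [wd xR ->]; apply: szm => //.
  by rewrite -def mem_cat wd.
apply: (loop_spec (Inv := fun don v => exists Ts : seq tree, [/\ v = lst Ts,
    size Ts = size don * size R & Ts =i [seq Node w x | w <- don, x <- R]])) => //.
- move=> don y rest acc def [Ts [-> szTs memT]] aB /=.
  have yU : y \in U by rewrite -def mem_cat mem_head orbT.
  have yB := ltnW (tree_size_mem yU).
  have le1 : (size don).+1 <= size U by rewrite -def size_cat /=; lia.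
  do 2!eexists; split.
    apply: cons_spec; last by lia.
    have := szT don _ Ts def memT szTs.
    have := @tree_size_lst [seq Node y x | x <- R] m.
    rewrite size_map => szyR; have {}szyR := szyR _.
    have: tree_size (lst [seq Node y x | x <- R]) <= size R * m.+1 + 1.
      by apply: szyR => z /mapP[x xR ->]; apply: szm.
    by have := leq_mul (leq_mul le1 (leqnn (size R))) (leqnn m.+1); lia.
  move=> _ <-; split; last by rewrite /Tcall; lia.
  eexists; split; first by [].
    by rewrite size_cat size_rev size_map size_rcons szTs; lia.
  move=> z; rewrite mem_cat mem_rev memT; apply/orP/allpairsP.
    case=> [/mapP[x xR ->]|/allpairsP[[w x] /= [wd xR ->]]].
      by exists (y, x); rewrite mem_rcons mem_head.
    by exists (w, x); rewrite mem_rcons inE wd orbT.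
  case=> -[w x] /= [+ xR ->]; rewrite mem_rcons inE => /predU1P[->|wd].
    by left; apply: map_f.
  by right; apply/allpairsP; exists (w, x).
- move=> don rest acc def [Ts [-> szTs memT]].
  have := szT _ _ _ def memT szTs.
  have le1 : (size don) <= size U by rewrite -def size_cat /=; lia.
  by have := leq_mul (leq_mul le1 (leqnn (size R))) (leqnn m.+1); lia.
- by exists [::].
Qed.

(** Tuples grow at the front, so the factors are consumed in reverse. This is why [iSet] reverses
    its list beforehand, while [iRound] does not: its list of filters already comes out reversed.
    The bound is [n ^ m] tuples with at most [m] entries of size at most [s]; [0 < n] makes it valid
    for the partial products too. *)
Lemma choices_spec (Ls : seq (seq tree)) n s m :
  0 < n -> size Ls <= m ->
  (forall L, L \in Ls -> size L <= n /\ forall x, x \in L -> tree_size x <= s) ->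
  tree_size (lst (map lst Ls)) <= B -> n ^ m * (m * s.+1 + 2) + 3 <= B ->
  fspec iChoices (Node Leaf (Node (lst (map lst Ls)) (enc_bool true)))
    (fun v => exists Ts : seq tree, [/\ v = lst Ts, size Ts <= n ^ m,
       tree_size v <= B &
       forall t, t \in Ts <-> all2 (fun x L => x \in L) (spine t) (rev Ls)])
    (Tchoices B).
Proof.
move=> n_gt0 szLs LsP LsB nB.
have szT i (Ts : seq tree) : i <= size Ls -> size Ts <= n ^ i -> (forall t, t \in Ts <->
      all2 (fun x L => x \in L) (spine t) (rev (take i Ls))) ->
    tree_size (lst Ts) <= B /\ forall t, t \in Ts -> tree_size t <= i * s.+1 + 1.
  move=> lei szTs memT.
  have tP t : t \in Ts -> tree_size t <= i * s.+1 + 1.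
    move/memT; rewrite all2E => /andP[/eqP szt /allP allt].
    rewrite size_rev size_takel // in szt.
    rewrite -[t]spineK; apply: leq_trans (tree_size_lst (m := s) _) _;
      last by rewrite szt.
    move=> x /(nthP Leaf)[j ltj <-].
    have := allt (nth Leaf (spine t) j, nth [::] (rev (take i Ls)) j).
    have ltj' : j < size (rev (take i Ls)) by rewrite size_rev size_takel // -szt.
    rewrite -nth_zip ?mem_nth ?size_zip ?leq_min ?ltj ?ltj' //; last first.
      by rewrite size_rev size_takel.
    rewrite nth_zip ?size_rev ?size_takel // => /(_ isT) /=.
    apply: (proj2 (LsP _ _)).
    by apply: (@mem_take i); rewrite -mem_rev mem_nth.
  split=> //; apply: leq_trans (tree_size_lst tP) _.
  have lei' : (i * s.+1 + 1).+1 <= m * s.+1 + 2.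
    by rewrite -addn1 -addnA leq_add2r leq_mul2r; lia.
  have len : size Ts <= n ^ m.
    by apply: leq_trans szTs _; apply: leq_pexp2l => //; lia.
  by apply: leq_trans nB; apply: leq_add (leq_mul len lei') _.
apply: (spec_weaken (R := fun v => exists Ts : seq tree, [/\ v = lst Ts,
    size Ts <= n ^ size (map lst Ls) &
    forall t, t \in Ts <-> all2 (fun x L => x \in L) (spine t)
       (rev (take (size (map lst Ls)) Ls))])); last first.
- exact: leqnn.
- rewrite size_map => v [Ts [-> szTs memT]]; exists Ts; split=> //.
  + by apply: leq_trans szTs _; apply: leq_pexp2l.
  + by have [] := szT _ _ (leqnn _) szTs memT.
  by rewrite take_size in memT.
apply: (loop_spec (Inv := fun don v => exists Ts : seq tree, [/\ v = lst Ts,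
    size Ts <= n ^ size don &
    forall t, t \in Ts <-> all2 (fun x L => x \in L) (spine t)
       (rev (take (size don) Ls))])) => //.
- move=> don y rest acc def [Ts [-> szTs memT]] aB /=.
  have ltd : size don < size Ls by rewrite -(size_map lst) -def size_cat /=; lia.
  pose L := nth [::] Ls (size don).
  have yE : y = lst L.
    by rewrite /L -(nth_map _ Leaf) // -def nth_cat ltnn subnn.
  have LL : L \in Ls by apply: mem_nth.
  have [szL Ls_] := LsP L LL.
  have [TsB TsP] := szT _ _ (ltnW ltd) szTs memT.
  have LB : tree_size (lst L) <= B.
    exact: ltnW (leq_trans (tree_size_mem (map_f lst LL)) LsB).
  have szLT : size L * size Ts <= n ^ (size don).+1 by rewrite expnS leq_mul.
  do 2!eexists; split.
    rewrite yE; apply: (@extend_spec _ _ (m * s.+1 + 1)) => //.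
    + move=> w x /Ls_ ws /TsP /= xs.
      have: (size don).+1 * s.+1 <= m * s.+1 by rewrite leq_mul2r; lia.
      by rewrite mulSn; lia.
    + apply: leq_trans nB; apply: leq_add => //; apply: leq_mul; last by lia.
      by apply: leq_trans szLT _; apply: leq_pexp2l => //; lia.
  move=> _ [Ts' [-> szTs' memT']]; split.
    exists Ts'; split=> [//||t]; first by rewrite szTs' size_rcons.
    rewrite size_rcons (take_nth [::]) // rev_rcons -/L memT'.
    split=> [/allpairsP[[w x] /= [wL /memT xT ->]] /=|]; first by rewrite wL.
    case: t => [|w x] //= /andP[wL xT]; apply/allpairsP.
    by exists (w, x); split=> //; apply/memT.
  by rewrite yE /Tcall; lia.
- move=> don rest acc def [Ts [-> szTs memT]].
  have led : size don <= size Ls by rewrite -(size_map lst) -def size_cat; lia.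
  by have [] := szT _ _ led szTs memT.
- by rewrite /=; lia.
(* The initial accumulator [enc_bool true] doubles as the list whose only entry is the empty
   tuple. *)
- exists [:: Leaf]; split=> // t.
  by rewrite take0 inE; case: t => [|? ?]; split.
Qed.

Lemma leq_tree_size_catl don rest t : don ++ rest = spine t -> tree_size t <= B ->
  tree_size (lst don) <= B.
Proof.
move=> def; have := tree_size_cat don rest; rewrite def spineK.
by have := tree_size_gt0 (lst rest); lia.
Qed.

Lemma leq_tree_size_mid don y rest t : don ++ y :: rest = spine t ->
  tree_size t <= B -> tree_size y < B.
Proof.
move=> def; have := @spine_size y t; rewrite -def mem_cat mem_head orbT => /(_ isT).
exact: leq_trans.
Qed.

Lemma filter_spec q t : tree_size q <= B -> tree_size t <= B ->
  fspec iFilter (Node q (Node t Leaf)) (eq (lst (rev (select q (spine t)))))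
    (Tfilter B).
Proof.
move=> qB tB; rewrite -{1}[t]spineK.
apply: (loop_spec (Inv := fun don acc => lst (rev (select q don)) = acc)) => //.
- move=> don y rest acc def <- aB /=.
  have yB := leq_tree_size_mid def tB.
  have := tree_size_hd y; have := tree_size_tl y => szt szh.
  do 2!eexists; split; first by apply: eq_spec => //; lia.
  rewrite /select in aB *; move=> _ <-; rewrite filter_rcons.
  case: eqP => _ /=; (split; last by rewrite /Tcall; lia) => //.
  by rewrite map_rcons rev_rcons.
- move=> don rest acc def <-; rewrite tree_size_rev.
  exact: leq_trans (tree_size_select _ _) (leq_tree_size_catl def tB).
- by rewrite spineK.
Qed.

Lemma filters_spec t qs : tree_size t <= B -> tree_size qs <= B ->
  size (spine qs) * (tree_size t).+1 + 1 <= B ->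
  fspec iFilters (Node t (Node qs Leaf))
    (eq (lst (rev [seq lst (rev (select q (spine t))) | q <- spine qs])))
    (Tfilters B).
Proof.
move=> tB qsB szB; rewrite -{1}[qs]spineK.
apply: (loop_spec (Inv := fun don acc =>
   lst (rev [seq lst (rev (select q (spine t))) | q <- don]) = acc)) => //.
- move=> don y rest acc def <- aB /=.
  have yB := leq_tree_size_mid def qsB.
  do 2!eexists; split; first by apply: filter_spec => //; lia.
  move=> _ <-; rewrite map_rcons rev_rcons; split=> //.
  rewrite !tree_size_rev in aB *; have := tree_size_select y (spine t).
  by rewrite spineK /Tcall; lia.
- move=> don rest acc def <-; rewrite tree_size_rev.
  apply: leq_trans szB; apply: leq_trans (tree_size_lst (m := tree_size t) _) _.
    move=> _ /mapP[q _ ->]; rewrite tree_size_rev -[X in _ <= tree_size X]spineK.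
    exact: tree_size_select.
  by rewrite leq_add2r size_map leq_mul2r -def size_cat leq_addr orbT.
- by rewrite spineK.
Qed.

Definition memX p t :=
  has (fun x => (hd p == hd x) && set_eqb (tl p) (tl x)) (spine t).

Lemma memX_spec p t : tree_size p <= B -> tree_size t <= B ->
  fspec iMemX (Node p (Node t Leaf)) (eq (enc_bool (memX p t))) (TmemX B).
Proof.
move=> pB tB; rewrite -{1}[t]spineK.
apply: (loop_spec (Inv := fun don acc => enc_bool
   (has (fun x => (hd p == hd x) && set_eqb (tl p) (tl x)) don) = acc)) => //.
- move=> don y rest acc def <- aB /=; rewrite has_rcons.
  have yB := leq_tree_size_mid def tB.
  have := tree_size_hd y; have := tree_size_tl y => szt szh.
  have := tree_size_hd p; have := tree_size_tl p => szt' szh'.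
  do 2!eexists; split; first by apply: eq_spec => //; lia.
  move=> _ <-; case: eqP => _ /=; last by split; rewrite // /Tcall; lia.
  do 2!eexists; split; first by apply: set_eqb_spec => //; lia.
  by move=> _ <-; case: set_eqb => /=; split; rewrite // /Tcall; lia.
- by move=> don _ acc _ <-; apply: leq_trans (tree_size_bool _) (ltnW _).
- by rewrite spineK.
Qed.

Lemma insert_spec p t : tree_size p <= B -> tree_size t <= B ->
  fspec iInsert (Node p t) (eq (if memX p t then t else Node p t)) (Tinsert B).
Proof.
move=> pB tB; apply: wp_spec => /=.
do 2!eexists; split; first exact: memX_spec.
by move=> _ <-; case: memX => /=; split=> //; rewrite /Tinsert /Tcall; lia.
Qed.

End Lists.

(** * Correctness of the saturation *)

Definition dec_str (t : tree) : witness := [seq x != Leaf | x <- spine t].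

Lemma enc_strK : cancel enc_str dec_str.
Proof.
move=> w; rewrite /enc_str enc_seqE /dec_str lstK -map_comp.
by rewrite -[RHS]map_id; apply: eq_map => -[].
Qed.

Lemma dec_strsK ws : map dec_str (spine (enc_seq enc_str ws)) = ws.
Proof.
rewrite enc_seqE lstK -map_comp -[RHS]map_id.
by apply: eq_map => w; rewrite /= enc_strK.
Qed.

Lemma enc_nat_inj : injective enc_nat.
Proof.
move=> m n /(congr1 (size \o spine)); rewrite /enc_nat !enc_seqE /=.
by rewrite !lstK !size_map !size_nseq.
Qed.

Lemma tree_size_enc_nat n : tree_size (enc_nat n) = 2 * n + 1.
Proof. by rewrite /enc_nat; elim: n => //= n ->; lia. Qed.

Lemma tree_size_enc_str w : tree_size (enc_str w) <= 4 * size w + 1.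
Proof. by elim: w => //= b w; have := tree_size_bool b; lia. Qed.

(** * Trees that represent sets of witnesses *)

Section Codes.
Implicit Types (S : {fset witness}) (x y : tree).

Lemma codes_setE S x : codes_set S x <-> exists s : seq witness,
  [/\ uniq s, s =i S & x = lst (map enc_str s)].
Proof.
by split=> -[s [us eqs ->]]; exists s; rewrite ?enc_seqE; split=> //; rewrite enc_seqE.
Qed.

Lemma codes_set_fun S S' x : codes_set S x -> codes_set S' x -> S = S'.
Proof.
case/codes_setE=> s [_ eqs ->] /codes_setE[s' [_ eqs' /(can_inj lstK)]].
move/(inj_map (can_inj enc_strK)) => eqss'.
by apply/fsetP => w; rewrite -eqs -eqs' eqss'.
Qed.

Lemma codes_set_eqb S S' x x' : codes_set S x -> codes_set S' x' ->
  set_eqb x x' = (S == S').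
Proof.
case/codes_setE=> s [_ eqs ->] /codes_setE[s' [_ eqs' ->]].
rewrite /set_eqb !lstK; apply/andP/eqP => [[/allP ss' /allP s's]|eqS].
  apply/fsetP => w; rewrite -eqs -eqs'; apply/idP/idP => [sw|s'w].
    by have := ss' _ (map_f _ sw); rewrite /= mem_map //; apply: can_inj enc_strK.
  by have := s's _ (map_f _ s'w); rewrite /= mem_map //; apply: can_inj enc_strK.
by split; apply/allP => _ /mapP[w sw ->]; apply: map_f;
  move: sw; rewrite eqs eqs' eqS.
Qed.

Lemma codes_set_size S x b : codes_set S x ->
  (forall w, w \in S -> size w <= b) ->
  size (spine x) = #|` S| /\ tree_size x <= #|` S| * (4 * b + 2) + 1.
Proof.
case/codes_setE=> s [us eqs ->] szS; rewrite lstK size_map.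
have <- : size s = #|` S|.
  exact: perm_size (uniq_perm us (fset_uniq S) eqs).
split=> //.
apply: leq_trans (tree_size_lst (m := 4 * b + 1) _) _; last first.
  rewrite size_map leq_add2r leq_mul2l; lia.
move=> _ /mapP[w sw ->]; apply: leq_trans (tree_size_enc_str w) _.
by rewrite leq_add2r leq_mul2l szS ?orbT // -eqs.
Qed.

End Codes.

Lemma Forall2_inr (T1 : Type) (T2 : eqType) (r : T1 -> T2 -> Prop) s1 s2 y :
  List.Forall2 r s1 s2 -> y \in s2 -> exists2 x, List.In x s1 & r x y.
Proof.
elim=> {s1 s2} //= x z s1 s2 rxz _ IH; rewrite inE => /predU1P[->|/IH[w]].
  by exists x => //; left.
by exists w => //; right.
Qed.

Lemma Forall2_size (T1 T2 : Type) (r : T1 -> T2 -> Prop) s1 s2 :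
  List.Forall2 r s1 s2 -> size s1 = size s2.
Proof. by elim=> //= *; congr S. Qed.

Local Arguments choices : simpl never.

(** The bridge from products of lists to [choices]: whichever lists represent the sets, the
    enumerated tuples are the codes of the same tuples of witnesses. *)
Lemma codes_set_choices Ss xs ys : List.Forall2 codes_set Ss xs ->
  all2 (fun y L => y \in L) ys (map spine xs) <->
  exists2 ws, ys = map enc_str ws & ws \in choices Ss.
Proof.
move=> rel; elim: rel ys => {Ss xs} [|S x Ss xs Sx _ IH] ys /=.
  case: ys => [|y ys] /=; split=> //; first by exists [::].
  by case=> ws yE; rewrite in_choices; case: ws yE.
have [s [_ eqs ->]] := (codes_setE S x).1 Sx; rewrite lstK.
case: ys => [|y ys] /=; split=> //.
- by case=> ws yE; rewrite in_choices; case: ws yE.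
- case/andP=> /mapP[w sw ->] /IH[ws -> wsP]; exists (w :: ws) => //.
  by rewrite in_choices /= -eqs sw -in_choices.
- case=> -[|w ws] //= [-> ->]; rewrite in_choices /= -in_choices => /andP[Sw wsP].
  by rewrite map_f ?eqs //=; apply/IH; exists ws.
Qed.

Lemma List_In_mem (T : eqType) (s : seq T) x : List.In x s -> x \in s.
Proof.
by elim: s => //= y s IHs [->|/IHs]; rewrite inE ?eqxx // => ->; rewrite orbT.
Qed.

(** * The program for a fixed parameter and automaton *)

Section Algorithm.
Variables (C : dp_core) (k : nat) (A : automaton) (impl : routine -> program void).
Let Sg := core_alphabet C k.
Hypothesis autA : automaton_over Sg A.
Notation X := (link impl).
Notation fspec := (fspec X inclusion_program).
Let K := enc_nat k.

(** Bounds: [mu] and [be] for cardinality and witness length of the sets [dyn], [N] for the number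
    of pairs, [R] for arities, [sg] for the size of one result of [step], [asz] for the automaton,
    and [B] for all data and all routine calls. Consequently [sz] bounds the code of a set and [xsz]
    that of the list of pairs. The hypotheses on [B] make room for basic data, for the filtered
    lists, for tuples of pairs, for tuples of witnesses and for the union of all step results. *)
Variables (mu be N R sg asz B : nat).
Let sz := mu * (4 * be + 2) + 1.
Let xsz := N * (asz + sz + 2) + 1.
Hypothesis dynP : forall tau, term_over Sg tau ->
  #|` dyn C k tau| <= mu /\ forall w, w \in dyn C k tau -> size w <= be.
Hypothesis mu_gt0 : 0 < mu.
Hypothesis N_gt0 : 0 < N.
Hypothesis arityR : forall a, a \in Sg -> arity a <= R.
Hypothesis aszP : tree_size (enc_automaton A) <= asz.
Hypothesis B1 : 2 * k + 3 * asz + sz + xsz + 30 <= B.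
Hypothesis B2 : R * xsz.+1 + 1 <= B.
Hypothesis B3 : N ^ R * (R * sz.+1 + 2) + 3 <= B.
Hypothesis B4 : mu ^ R * (R * (4 * be + 1).+1 + 2) + 3 <= B.
Hypothesis B5 : (mu ^ R + 1) * sg + 3 <= B.

Hypothesis NP : forall L : seq (nat * {fset witness}), uniq L ->
  (forall l, l \in L -> [/\ l.1 < nstates A, #|` l.2| <= mu &
     forall w, w \in l.2 -> size w <= be]) -> size L <= N.

Definition routine_ok q x out :=
  exists v t, [/\ out v : Prop, t <= B & X q x v t].

Hypothesis base_ok : forall a, a \in Sg -> arity a = 0 ->
  tree_size (enc_symbol a) <= asz ->
  routine_ok RBase (Node K (enc_symbol a)) (codes_set (base C k a)).
Hypothesis step_ok : forall a ws, a \in Sg -> 0 < arity a ->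
  tree_size (enc_symbol a) <= asz ->
  size ws = arity a -> all (wit C k) ws -> all (fun w => size w <= be) ws ->
  routine_ok RStep (Node K (Node (enc_symbol a) (enc_seq enc_str ws)))
    (fun v => codes_set (step C k a ws) v /\ tree_size v <= sg).
Hypothesis clean_ok : forall (S : {fset witness}) x, {subset S <= wit C k} ->
  codes_set S x -> tree_size x <= mu ^ R * sg + 1 ->
  routine_ok RClean (Node K x) (codes_set (clean C k S)).
Hypothesis fin_ok : forall w, wit C k w -> size w <= be ->
  routine_ok RFin (Node K (enc_str w)) (eq (enc_bool (fin C k w))).

Definition Tstep B := Tloop (Tcall (Tunion B + B) B) B.
Definition Tset B := Tcall (Trev B + Tchoices B + Tstep B + B) B.
Definition Ttuples B := Tloop (Tcall (Tset B + Tinsert B) B) B.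
Definition Tround B := Tloop (Tcall (Tfilters B + Tchoices B + Ttuples B) B) B.
Definition Tfix B := B.+1 * Tcall (Tround B + Teq B) B.
Definition Tfinal B := Tloop (Tcall B B) B.
Definition Tcheck B := Tloop (Tcall (Tmem B + Tfinal B) B) B.

Let B_ge4 : 3 < B. Proof. by lia. Qed.
Let KE : tree_size K = 2 * k + 1. Proof. exact: tree_size_enc_nat. Qed.

(** At most [mu ^ R] tuples contribute at most [sg] each, which bounds the union and with it the
    input of [clean]. *)
Lemma steps_spec a Ts : a \in Sg -> 0 < arity a -> tree_size (enc_symbol a) <= asz ->
  size Ts <= mu ^ R -> tree_size (lst Ts) <= B ->
  (forall t, t \in Ts -> exists ws, [/\ t = enc_seq enc_str ws, size ws = arity a,
     all (wit C k) ws & all (fun w => size w <= be) ws]) ->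
  fspec iStep (Node (Node K (enc_symbol a)) (Node (lst Ts) Leaf))
    (fun v => tree_size v <= mu ^ R * sg + 1 /\ exists s : seq witness,
      [/\ v = enc_seq enc_str s, uniq s &
        forall w, w \in s = has (fun t => w \in step C k a (map dec_str (spine t))) Ts])
    (Tstep B).
Proof.
move=> Sa a_gt0 szA szTs TsB TsP.
have szd (don rest : seq tree) : don ++ rest = Ts -> size don * sg + 1 <= B.
  move=> def; have: size don <= size Ts by rewrite -def size_cat; lia.
  by move=> le; have := leq_mul (leq_trans le szTs) (leqnn sg); lia.
pose Inv (don : seq tree) (acc : tree) := exists s : seq witness,
  [/\ acc = enc_seq enc_str s, uniq s, tree_size acc <= size don * sg + 1 &
    forall w, w \in s = has (fun t => w \in step C k a (map dec_str (spine t))) don].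
apply: (spec_weaken (R := Inv Ts)); last exact: leqnn.
  apply: (loop_spec (Inv := Inv)) => //=.
  - move=> don t rest acc def [s [-> us szs memS]] aB.
    have tTs : t \in Ts by rewrite -def mem_cat mem_head orbT.
    have szt := ltnW (leq_trans (tree_size_mem tTs) TsB).
    have [ws [tE szws witws leb]] := TsP t tTs; rewrite tE in szt *.
    do 2!eexists; split; first exact: step_ok.
    move=> v [/codes_setE[s' [us' eqs' ->]] szv].
    have szvs : tree_size (lst (map enc_str s')) +
        tree_size (enc_seq enc_str s) <= (size don).+1 * sg + 1.
      by rewrite mulSn; lia.
    have szB : (size don).+1 * sg + 1 <= B.
      have def' : rcons don t ++ rest = Ts by rewrite cat_rcons.
      by have := szd _ _ def'; rewrite size_rcons.
    do 2!eexists; split.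
      by apply: (union_spec _ B_ge4); apply: leq_trans szvs szB.
    move=> u []; rewrite [enc_seq _ _]enc_seqE !lstK => memu uniqu szu.
    (* Every element of [u] stems from one of the two united codes, so decoding loses nothing. *)
    have encu : spine u = map enc_str (map dec_str (spine u)).
      rewrite -map_comp -[LHS]map_id; apply/eq_in_map => x.
      rewrite memu mem_cat => /orP[] /mapP[w _ ->] /=; by rewrite enc_strK.
    split.
      exists (map dec_str (spine u)); split.
      + by rewrite enc_seqE -encu spineK.
      + rewrite -(map_inj_uniq (can_inj enc_strK)) -encu uniqu //.
        by rewrite (map_inj_uniq (can_inj enc_strK)).
      + by rewrite size_rcons; rewrite enc_seqE in szvs; lia.
      + move=> w; rewrite -(mem_map (can_inj enc_strK)) -encu memu mem_cat.
        rewrite !(mem_map (can_inj enc_strK)) has_rcons memS eqs'.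
        rewrite enc_seqE lstK -map_comp; congr (_ || _).
        by rewrite (eq_map (g := id)) ?map_id // => x /=; rewrite enc_strK.
    move: szA (leq_trans szvs szB) aB szt.
    by rewrite /Tcall /enc_symbol !enc_seqE /=; lia.
  - move=> don rest acc def [s [-> us szs _]].
    exact: leq_trans szs (szd _ _ def).
  - by rewrite /enc_symbol /= in szA; lia.
  - by exists [::]; split=> //; lia.
move=> v [s [-> us szs memS]]; split; last by exists s.
by apply: leq_trans szs _; rewrite leq_add2r leq_mul.
Qed.


(** The term is remembered because both the size bounds and membership in [wit] are known only for
    sets that some term produces. *)
Definition codes_term t x := term_over Sg t /\ codes_set (dyn C k t) x.

Lemma codes_term_choices ts xs : List.Forall2 codes_term ts xs ->
  List.Forall2 codes_set (map (dyn C k) ts) xs.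
Proof. by elim=> [|t x {}ts {}xs [_ tx] _ IH]; constructor. Qed.

Lemma codes_term_wit ts xs ws : List.Forall2 codes_term ts xs ->
  ws \in choices (map (dyn C k) ts) ->
  [/\ size ws = size ts, all (wit C k) ws & all (fun w => size w <= be) ws].
Proof.
rewrite in_choices => rel; elim: rel ws => {ts xs} [|t x ts xs [St _] _ IH] [|w ws] //=.
case/andP=> tw /IH[-> -> ->]; rewrite [wit _ _ _](dyn_wit St tw) /=.
by have [_ ->] := dynP St.
Qed.

Lemma codes_term_size t x : codes_term t x ->
  size (spine x) <= mu /\ tree_size x <= sz.
Proof.
case=> St tx; have [leS leb] := dynP St; have [-> le] := codes_set_size tx leb.
by split=> //; apply: leq_trans le _; rewrite /sz leq_add2r leq_mul2r leS orbT.
Qed.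

Lemma set_spec a ts xs : a \in Sg -> tree_size (enc_symbol a) <= asz ->
  size ts = arity a -> List.Forall2 codes_term ts xs -> tree_size (lst xs) <= B ->
  fspec iSet (Node (Node K (enc_symbol a)) (lst xs))
    (codes_set (dyn C k (Term a ts))) (Tset B).
Proof.
move=> Sa szA szts rel xsB; rewrite /fspec; apply: wp_spec.
rewrite [nth _ _ _]/=.
(* [iSet] branches on the unary arity stored in the symbol, which is a leaf exactly for arity 0. *)
case aE: a => [nm [|ar]].
  have a0 : arity a = 0 by rewrite aE.
  have base_a := base_ok Sa a0 szA; rewrite /= in base_a *.
  do 2!eexists; split; first by rewrite aE in base_a; exact: base_a.
  by move=> v cv; split=> //; rewrite /Tset /Tcall; lia.
have a_gt0 : 0 < arity a by rewrite aE.
rewrite [wp _ _ _ _ _]/= -aE -/(enc_symbol a).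
do 2!eexists; split; first by apply: (rev_spec _ B_ge4).
move=> _ <-; rewrite lstK.
pose Ls := rev (map spine xs).
have LsE : rev xs = map lst Ls.
  rewrite /Ls map_rev -map_comp; congr rev.
  by rewrite -[LHS]map_id; apply: eq_map => x; rewrite /= spineK.
have szxs : size xs = arity a by rewrite -(Forall2_size rel).
do 2!eexists; split.
  rewrite LsE; apply: (choices_spec _ B_ge4 mu_gt0 _ _ _ B4).
  - by rewrite size_rev size_map szxs arityR.
  - move=> L; rewrite mem_rev => /mapP[x xsx ->].
    have [t _ tx] := Forall2_inr rel xsx.
    have [szx _] := codes_term_size tx; split=> // y.
    have [St tx'] := tx; have [s [_ eqs ->]] := (codes_setE _ _).1 tx'.
    rewrite lstK => /mapP[w sw ->].
    have [_ leb] := dynP St; have := leb w; rewrite -eqs => /(_ sw) lew.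
    by apply: leq_trans (tree_size_enc_str w) _; rewrite leq_add2r leq_mul2l lew orbT.
  - by rewrite -LsE tree_size_rev.
move=> _ [Ts [-> szTs TsB memT]]; rewrite revK in memT.
have {}memT t : t \in Ts <->
    exists2 ws, t = enc_seq enc_str ws & ws \in choices (map (dyn C k) ts).
  split=> [/memT|[ws tE wsP]].
    case/(codes_set_choices _ (codes_term_choices rel)) => ws tE wsP.
    by exists ws => //; rewrite enc_seqE -tE spineK.
  apply/memT/(codes_set_choices _ (codes_term_choices rel)); exists ws => //.
  by rewrite tE enc_seqE lstK.
pose S := (\bigcup_(ws <- choices (map (dyn C k) ts)) step C k a ws)%fset.
do 2!eexists; split.
  apply: (steps_spec Sa a_gt0 szA szTs TsB) => t /memT[ws -> wsP].
  by have [szws wit_ws leb] := codes_term_wit rel wsP; exists ws; rewrite -szts.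
move=> v [szv [s [vE us memS]]].
have cS : codes_set S v.
  exists s; split=> // w; rewrite memS; apply/hasP/bigfcupP => [[t]|[ws]].
    by case/memT=> ws ->; exists ws; rewrite ?andbT // -[ws]dec_strsK.
  by rewrite andbT => wsP wS; exists (enc_seq enc_str ws);
    [apply/memT; exists ws | rewrite dec_strsK].
have witS : {subset S <= wit C k}.
  move=> w /bigfcupP[ws]; rewrite andbT => wsP.
  have [szws wit_ws _] := codes_term_wit rel wsP.
  by apply: step_wit; rewrite // szws.
do 2!eexists; split; first exact: clean_ok witS cS szv.
have {}szv : tree_size v <= B by lia.
move=> u cu; split=> //.
move: szA; rewrite aE /enc_symbol /= /Tset /Tcall.
rewrite tree_size_rev; move: xsB TsB szv.
by set x1 := tree_size (lst xs); set x2 := tree_size (lst Ts); lia.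
Qed.


(** * Invariants of the saturation *)

Implicit Types (L : seq (nat * {fset witness})) (d : symbol * seq nat * nat).

Definition apply_symbol a Ss : {fset witness} :=
  if arity a == 0 then base C k a else step_set C k a Ss.

Definition sound (l : nat * {fset witness}) := exists tau,
  [/\ term_over Sg tau, l.1 \in reached A tau & l.2 = dyn C k tau].

(** [L] lists the pairs in the order of [x]; only the enumeration inside each set is left open. *)
Definition repr L x := List.Forall2
  (fun l y => hd y = enc_nat l.1 /\ codes_set l.2 (tl y)) L (spine x).

Definition valid L x := [/\ repr L x, uniq L & forall l, l \in L -> sound l].

(** A round reads the pairs known at its start and writes into a growing list, hence two arguments;
    saturation is the case [L' = L]. *)
Definition closed_under L L' := forall d Ss, d \in transitions A ->
  all2 (fun q S => (q, S) \in L) d.1.2 Ss -> (d.2, apply_symbol d.1.1 Ss) \in L'.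

(* An unchanged length forces an unchanged tree: this is why comparing trees
   detects that a round has added nothing. *)
Definition extends L (x : tree) L' (x' : tree) :=
  [/\ {subset L <= L'}, size L <= size L' &
      size L' = size L -> x' = x].

Lemma extends_refl L x : extends L x L x.
Proof. by split. Qed.

Lemma extends_trans L1 x1 L2 x2 L3 x3 :
  extends L1 x1 L2 x2 -> extends L2 x2 L3 x3 -> extends L1 x1 L3 x3.
Proof.
case=> sub12 le12 eq12 [sub23 le23 eq23]; split; last 1 first.
- by move=> eq13; rewrite eq23 ?eq12 //; lia.
- by move=> l /sub12/sub23.
- exact: leq_trans le23.
Qed.

Lemma transitionsP d : d \in transitions A ->
  [/\ d.1.1 \in Sg, size d.1.2 = arity d.1.1 & d.2 < nstates A].
Proof. by have /andP[/allP trP _] := autA => /trP/and4P[? /eqP]. Qed.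

Lemma reachedP a ts q : q \in reached A (Term a ts) <-> exists d,
  [/\ d \in transitions A, d.1.1 = a, d.2 = q &
     all2 (fun p t => p \in reached A t) d.1.2 ts].
Proof.
have all2_map : forall ps, all2 (fun p (Q : seq nat) => p \in Q) ps
    [seq reached A t | t <- ts] = all2 (fun p t => p \in reached A t) ps ts.
  by elim: ts => [|t ts IHts] [|p ps] //=; rewrite IHts.
split=> [/mapP[d] /=|[d [dA <- <- dts]]].
  by rewrite mem_filter all2_map => /andP[/andP[/eqP ? ?] ?] ->; exists d.
by apply/mapP; exists d; rewrite // mem_filter all2_map eqxx dts.
Qed.

Lemma sound_bounds l : sound l -> [/\ l.1 < nstates A, #|` l.2| <= mu &
  forall w, w \in l.2 -> size w <= be].
Proof.
case=> -[a ts] [St + ->]; have [le1 le2] := dynP St.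
by case/reachedP=> d [/transitionsP[_ _ ltd] _ <- _].
Qed.

(** The unary number of states is part of the code of the automaton, so every single state has a
    code smaller than [asz] too. *)
Lemma enc_nstates : tree_size (enc_nat (nstates A)) < asz.
Proof.
by apply: leq_trans aszP => /=; have := tree_size_gt0 (enc_seq enc_nat (finals A)); lia.
Qed.

Lemma valid_size L x : valid L x ->
  [/\ size L <= N, size (spine x) = size L & tree_size x <= xsz].
Proof.
case=> rep uniqL soundL.
have szx : size (spine x) = size L by rewrite (Forall2_size rep).
have szL : size L <= N by apply: NP => // l /soundL/sound_bounds.
split=> //; rewrite -[x]spineK.
apply: leq_trans (tree_size_lst (m := asz + sz + 1) _) _; last first.
  by rewrite szx /xsz leq_add2r; apply: leq_mul => //; lia.
move=> y /(Forall2_inr rep)[l /List_In_mem/soundL/sound_bounds[ltl le1 le2] [hdy tly]].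
have [_ sztl] := codes_set_size tly le2.
have: tree_size (tl y) <= sz.
  by apply: leq_trans sztl _; rewrite /sz leq_add2r leq_mul2r le1 orbT.
have: tree_size (hd y) < asz.
  by have := enc_nstates; rewrite hdy !tree_size_enc_nat; lia.
by case: (y) => /=; lia.
Qed.

Lemma memX_repr L x q S y : repr L x -> codes_set S y ->
  memX (Node (enc_nat q) y) x = ((q, S) \in L).
Proof.
move=> rep Sy; rewrite /memX /=.
elim: rep => {L} [|[p U] z L zs [/= hdz tlz] _ IH] //=.
by rewrite IH inE hdz (inj_eq enc_nat_inj) (codes_set_eqb Sy tlz) -pair_eqE.
Qed.

Lemma select_repr L x q y : repr L x -> y \in select (enc_nat q) (spine x) ->
  exists2 S, (q, S) \in L & codes_set S y.
Proof.
rewrite /select => rep.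
elim: rep => {L} [|[p U] z L zs [/= hdz tlz] _ IH] //=.
rewrite hdz (inj_eq enc_nat_inj); case: eqP => [qp|_] /=; last first.
  by case/IH=> S LS Sy; exists S; rewrite // inE LS orbT.
rewrite inE => /predU1P[->|]; first by exists U; rewrite // qp mem_head.
by case/IH=> S LS Sy; exists S; rewrite // inE LS orbT.
Qed.

Lemma repr_select L x q S : repr L x -> (q, S) \in L ->
  exists2 y, y \in select (enc_nat q) (spine x) & codes_set S y.
Proof.
rewrite /select => rep.
elim: rep => {L} [|[p U] z L zs [/= hdz tlz] _ IH] //=.
rewrite hdz (inj_eq enc_nat_inj) inE => /predU1P[[-> ->]|/IH[y yz Sy]].
  by exists (tl z) => //; rewrite eqxx mem_head.
by exists y => //; case: eqP => _ //=; rewrite inE yz orbT.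
Qed.

Lemma insert_valid L x q S y : valid L x -> sound (q, S) -> codes_set S y ->
  fspec iInsert (Node (Node (enc_nat q) y) x)
    (fun x' => exists L', [/\ valid L' x', extends L x L' x' & (q, S) \in L'])
    (Tinsert B).
Proof.
move=> vLx soundS Sy; have [_ _ szx] := valid_size vLx.
have [rep uL soundL] := vLx.
have [ltq leS leb] := sound_bounds soundS.
have [_ szy] := codes_set_size Sy leb.
have {}szy : tree_size y <= sz.
  by apply: leq_trans szy _; rewrite /sz leq_add2r leq_mul2r leS orbT.
have := enc_nstates; rewrite /= in ltq; rewrite tree_size_enc_nat => ltn.
apply: (spec_weaken (insert_spec _ B_ge4 _ _)); last exact: leqnn.
- by rewrite /= tree_size_enc_nat; lia.
- by lia.
move=> _ <-; rewrite (memX_repr _ rep Sy); case: ifP => LS.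
  by exists L; split=> //; apply: extends_refl.
exists ((q, S) :: L); split; rewrite ?mem_head //.
  split; first by constructor.
    by rewrite /= LS.
  by move=> l; rewrite inE => /predU1P[->|/soundL].
split=> [l lL|/=|/= eqsz]; first by rewrite inE lL orbT.
  exact: leqnSn.
by lia.
Qed.

Lemma codes_set_map ts xs Ss : List.Forall2 codes_term ts xs ->
  List.Forall2 codes_set Ss xs -> Ss = map (dyn C k) ts.
Proof.
move=> rel; elim: rel Ss => {ts xs} [|t x ts xs [_ tx] _ IH] Ss rel.
  by inversion rel.
inversion_clear rel; rewrite /= (codes_set_fun tx H); congr (_ :: _).
exact: IH.
Qed.

Lemma tuples_spec d L x Ts : d \in transitions A -> tree_size (enc_symbol d.1.1) <= asz ->
  valid L x -> tree_size (lst Ts) <= B ->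
  (forall t, t \in Ts -> exists2 ts, List.Forall2 codes_term ts (spine t) &
     all2 (fun q tau => q \in reached A tau) d.1.2 ts) ->
  fspec iTuples (Node (Node (Node K (enc_symbol d.1.1)) (enc_nat d.2))
      (Node (lst Ts) x))
    (fun x' => exists L', [/\ valid L' x', extends L x L' x' &
       forall t Ss, t \in Ts -> List.Forall2 codes_set Ss (spine t) ->
         (d.2, apply_symbol d.1.1 Ss) \in L']) (Ttuples B).
Proof.
move=> dA szd vLx TsB TsP; have [dSg szqs ltd] := transitionsP dA.
have := enc_nstates; rewrite tree_size_enc_nat => ltn.
apply: (loop_spec (Inv := fun don x' => exists L', [/\ valid L' x', extends L x L' x' &
       forall t Ss, t \in don -> List.Forall2 codes_set Ss (spine t) ->
         (d.2, apply_symbol d.1.1 Ss) \in L'])) => //.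
- move=> don t rest x' def [L' [vLx' ext doneL]] x'B /=.
  have tTs : t \in Ts by rewrite -def mem_cat mem_head orbT.
  have szt := ltnW (leq_trans (tree_size_mem tTs) TsB).
  have [ts rel qts] := TsP t tTs.
  have szts : size ts = arity d.1.1.
    by rewrite -szqs; move: qts; rewrite all2E => /andP[/eqP].
  do 2!eexists; split.
    by rewrite -[t]spineK; apply: set_spec rel _ => //; rewrite spineK.
  move=> y cy.
  (* The terms behind the entries of the tuple are assembled under the symbol of [d] into a term
     that justifies the new pair. *)
  have snd : sound (d.2, dyn C k (Term d.1.1 ts)).
    exists (Term d.1.1 ts); split=> //.
      rewrite /= dSg szts eqxx /=; elim: rel => //= {}t {}x' {}ts {}xs [-> _] //.
    by apply/reachedP; exists d.
  do 2!eexists; split; first exact: insert_valid vLx' snd cy.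
  move=> x'' [L'' [vLx'' ext' memL'']]; split.
    exists L''; split=> //; first exact: extends_trans ext ext'.
    move=> u Ss; rewrite mem_rcons inE => /predU1P[->|ud] relSs.
      by rewrite (codes_set_map rel relSs).
    by have [sub _ _] := ext'; apply: sub; apply: doneL relSs.
  have [_ leS leb] := sound_bounds snd.
  have [_ szy] := codes_set_size cy leb.
  have {}szy : tree_size y <= sz.
    by apply: leq_trans szy _; rewrite /sz leq_add2r leq_mul2r leS orbT.
  rewrite /enc_symbol /= in szd.
  by rewrite /Tcall !tree_size_enc_nat in szd * => /=; lia.
- move=> don rest x' def [L' [vLx' _ _]]; have [_ _ szx'] := valid_size vLx'; lia.
- by rewrite /enc_symbol /= !tree_size_enc_nat in szd *; lia.
- by exists L; split=> //; apply: extends_refl.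
Qed.

Definition enc_transition d : tree :=
  Node (enc_symbol d.1.1) (Node (enc_seq enc_nat d.1.2) (enc_nat d.2)).

Lemma enc_transition_inj : injective enc_transition.
Proof.
move=> [[[a m] ps] p] [[[b n] qs] q] [].
move=> /(can_inj enc_strK)-> /enc_nat_inj->.
by rewrite !enc_seqE => /(can_inj lstK)/(inj_map enc_nat_inj)-> /enc_nat_inj->.
Qed.

Let trans : tree := lst (map enc_transition (transitions A)).
Let final : tree := enc_seq enc_nat (finals A).

Lemma enc_automatonE :
  enc_automaton A = Node (enc_nat (nstates A)) (Node trans final).
Proof. by rewrite /enc_automaton /trans -enc_seqE. Qed.

Lemma sound_codes q S L x y : valid L x -> (q, S) \in L -> codes_set S y ->
  tree_size y <= sz.
Proof.
case=> _ _ soundL /soundL/sound_bounds[_ leS leb] Sy.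
have [_] := codes_set_size Sy leb => /leq_trans; apply.
by rewrite /sz leq_add2r leq_mul2r leS orbT.
Qed.

Lemma round_spec L x : valid L x ->
  fspec iRound (Node (Node K x) (Node trans x))
    (fun x' => exists L', [/\ valid L' x', extends L x L' x' & closed_under L L'])
    (Tround B).
Proof.
move=> vLx; have [szL szx xB] := valid_size vLx; have [rep uL soundL] := vLx.
have transB : tree_size trans <= asz.
  by apply: leq_trans aszP; rewrite enc_automatonE /=; lia.
pose Inv (don : seq tree) x' := exists L', [/\ valid L' x', extends L x L' x' &
  forall d Ss, d \in transitions A -> enc_transition d \in don ->
    all2 (fun q S => (q, S) \in L) d.1.2 Ss -> (d.2, apply_symbol d.1.1 Ss) \in L'].
apply: (spec_weaken (R := Inv (map enc_transition (transitions A)))); last exact: leqnn.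
  apply: (loop_spec (Inv := Inv)) => //=;
    [| | by lia | by apply: leq_trans transB _; lia |]; last first.
  - by exists L; split=> //; apply: extends_refl.
  - by move=> don rest x' def [L' [/valid_size[_ _ szx'] _ _]]; lia.
  move=> don y rest x' def [L' [vLx' ext doneL]] x'B.
  have yA : y \in map enc_transition (transitions A).
    by rewrite -def mem_cat mem_head orbT.
  have szy : tree_size y < tree_size trans := tree_size_mem yA.
  have [d dA yE] := mapP yA; have [dSg szqs ltd] := transitionsP dA.
  have [szda [szdq szd2]] : tree_size (enc_symbol d.1.1) <= asz /\
      tree_size (enc_seq enc_nat d.1.2) <= asz /\ tree_size (enc_nat d.2) <= asz.
    have : (tree_size (enc_symbol d.1.1) +
        (tree_size (enc_seq enc_nat d.1.2) + tree_size (enc_nat d.2)).+1).+1 < asz.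
      by apply: leq_trans transB; rewrite yE in szy.
    by lia.
  have leqs : size (spine (enc_seq enc_nat d.1.2)) <= R.
    by rewrite enc_seqE lstK size_map szqs arityR.
  have [y1 y2 y3] : [/\ hd y = enc_symbol d.1.1, hd (tl y) = enc_seq enc_nat d.1.2 &
      tl (tl y) = enc_nat d.2] by rewrite yE.
  rewrite y1 y2 y3.
  do 2!eexists; split.
    apply: (filters_spec _ B_ge4); [by lia | by lia |].
    apply: leq_trans B2; rewrite leq_add2r; apply: leq_mul => //.
  move=> _ <-.
  pose Ls := rev [seq rev (select q (spine x)) | q <- spine (enc_seq enc_nat d.1.2)].
  have LsE : rev [seq lst (rev (select q (spine x))) | q <- spine (enc_seq enc_nat d.1.2)]
      = map lst Ls by rewrite /Ls map_rev -map_comp.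
  have LsP Lq : Lq \in Ls -> size Lq <= N /\ forall z, z \in Lq -> tree_size z <= sz.
    rewrite mem_rev => /mapP[q qd ->]; rewrite size_rev size_map size_filter.
    split; first by apply: leq_trans (count_size _ _) _; rewrite szx.
    move=> z; rewrite mem_rev; move: qd; rewrite enc_seqE lstK => /mapP[p _ ->].
    by case/(select_repr rep) => S; apply: sound_codes vLx.
  have szLs : size Ls <= R by rewrite size_rev size_map.
  have LsB : tree_size (lst (map lst Ls)) <= B.
    apply: leq_trans B2; apply: leq_trans (tree_size_lst (m := xsz) _) _.
      rewrite /Ls map_rev -map_comp => z; rewrite mem_rev => /mapP[q _ ->] /=.
      rewrite tree_size_rev; apply: leq_trans (tree_size_select _ _) _.
      by rewrite spineK.
    by rewrite leq_add2r size_map leq_mul.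
  do 2!eexists; split.
    by rewrite LsE; apply: (choices_spec _ B_ge4 N_gt0 szLs LsP LsB B3).
  move=> _ [Ts [-> szTs TsB memT]].
  rewrite /Ls revK in memT.
  do 2!eexists; split.
    apply: tuples_spec dA szda vLx' TsB _ => t /memT.
    rewrite enc_seqE lstK; elim: (d.1.2) (spine t) => [|q qs IH] [|z zs] //=.
      by exists [::]; [constructor|].
    case/andP; rewrite mem_rev => /(select_repr rep)[S LS Sz] /IH[ts rel qts].
    have [tau [Stau qtau /= SE]] := soundL _ LS.
    exists (tau :: ts); rewrite /= ?qtau //.
    by constructor=> //; split=> //; rewrite -SE.
  move=> x'' [L'' [vLx'' ext' memL'']]; split.
    exists L''; split=> //; first exact: extends_trans ext ext'.
    move=> e Ss eA; rewrite mem_rcons inE => /predU1P[eE|ed] LSs; last first.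
      by have [sub _ _] := ext'; apply: sub; apply: doneL LSs.
    have ed : e = d by apply: enc_transition_inj; rewrite eE.
    rewrite ed in LSs *.
    (* Each pair of [L] has a code in [x], so the chosen sets are represented by one of the
       enumerated tuples. *)
    have [zs relzs zsP] : exists2 zs, List.Forall2 codes_set Ss zs &
        all2 (fun z Lq => z \in Lq) zs
          [seq rev (select (enc_nat q) (spine x)) | q <- d.1.2].
      elim: (d.1.2) Ss LSs {ed} => [|q qs IH] [|S Ss] //=.
        by exists [::].
      case/andP=> /(repr_select rep)[z zP Sz] /IH[zs relzs zsP].
      by exists (z :: zs); [constructor | rewrite /= mem_rev zP].
    apply: (memL'' (lst zs)); last by rewrite lstK.
    by apply/memT; rewrite lstK enc_seqE lstK -map_comp.
  move: LsB TsB x'B; rewrite LsE /Tcall.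
  set u1 := tree_size (lst (map lst Ls)); set u2 := tree_size (lst Ts).
  set u3 := tree_size (enc_symbol _) in szda *.
  set u4 := tree_size (enc_seq _ _) in szdq *.
  set u5 := tree_size (enc_nat _) in szd2 *.
  by move=> *; lia.
move=> x' [L' [vLx' ext done]]; exists L'; split=> // d Ss dA.
by apply: done => //; apply: map_f.
Qed.

(** A round that changes the tree adds a pair, and at most [N] pairs exist; hence [N - size L]
    decreases with every recursive call. *)
Lemma fix_spec L x : valid L x ->
  fspec iFix (Node (Node K trans) x)
    (fun x' => exists2 L', valid L' x' & closed_under L' L')
    ((N - size L).+1 * Tcall (Tround B + Teq B) B).
Proof.
have transB : tree_size trans <= asz.
  by apply: leq_trans aszP; rewrite enc_automatonE /=; lia.
have [n] := ubnP (N - size L); elim: n L x => // n IHn L x leN vLx.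
have [szL szx xB] := valid_size vLx.
apply: wp_spec => /=.
do 2!eexists; split; first exact: (round_spec vLx).
move=> x' [L' [vLx' [sub leLL' eqLL'] closedL']].
have [szL' szx' x'B] := valid_size vLx'.
do 2!eexists; split; first by apply: (eq_spec _ (B := B)); lia.
move=> _ <-; case: eqP => [xx'|xx'] /=.
  (* Equal trees have equally many entries, and a duplicate-free list included in one of the same
     length has the same elements. *)
  have eqL : L =i L'.
    have [_ uL _] := vLx; have [|_ //] := uniq_min_size uL sub.
    by rewrite -szx -szx' xx'.
  split; last by apply: leq_trans (leq_pmull _ (ltn0Sn _)); rewrite /Tcall; lia.
  exists L' => // d Ss dA dSs; apply: closedL' => //.
  by move: dSs; rewrite !all2E => /andP[-> /=]; apply: sub_all => -[q S] /=; rewrite eqL.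
have ltLL' : size L < size L'.
  by rewrite ltn_neqAle leLL' andbT eq_sym; apply/eqP => /eqLL'/esym.
do 2!eexists; split; first by apply: IHn vLx'; lia.
move=> x'' Lx''; split=> //.
have le : (N - size L').+2 <= (N - size L).+1 by lia.
have := leq_mul le (leqnn (Tcall (Tround B + Teq B) B)).
rewrite [_.+2 * _]mulSn; apply: leq_trans.
by rewrite /Tcall; lia.
Qed.

Lemma final_spec (S : {fset witness}) y : {subset S <= wit C k} ->
  (forall w, w \in S -> size w <= be) -> codes_set S y -> tree_size y <= B ->
  fspec iFinal (Node K (Node y Leaf))
    (eq (enc_bool (has (fin C k) (enum_fset S)))) (Tfinal B).
Proof.
move=> witS leb /codes_setE[s [us eqs ->]] yB.
have -> : has (fin C k) (enum_fset S) = has (fin C k \o dec_str) (map enc_str s).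
  rewrite has_map (eq_has (a2 := fin C k)) ?(eq_has_r eqs) // => w.
  by rewrite /= enc_strK.
apply: (loop_spec (Inv := fun don v =>
  enc_bool (has (fin C k \o dec_str) don) = v)) => //=.
- move=> don t rest acc def <- _.
  have ts : t \in map enc_str s by rewrite -def mem_cat mem_head orbT.
  have tB := leq_trans (tree_size_mem ts) yB.
  have [w sw tw] := mapP ts; rewrite has_rcons /= {2}tw enc_strK.
  case: has => /=; first by rewrite orbT; split=> //; rewrite /Tcall; lia.
  rewrite orbF; do 2!eexists; split.
    by rewrite tw; apply: fin_ok; [apply: witS | apply: leb]; rewrite -eqs.
  by move=> v <-; split=> //; rewrite /Tcall; lia.
- by move=> don _ acc _ <-; have := tree_size_bool (has (fin C k \o dec_str) don); lia.
- by lia.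
Qed.

Definition check (l : nat * {fset witness}) : bool :=
  (l.1 \in finals A) ==> has (fin C k) (enum_fset l.2).

Lemma check_spec L x : valid L x ->
  fspec iCheck (Node (Node K final) (Node x (enc_bool true)))
    (eq (enc_bool (all check L))) (Tcheck B).
Proof.
move=> vLx; have [szL szx xB] := valid_size vLx; have [rep uL soundL] := vLx.
have finB : tree_size final <= asz.
  by apply: leq_trans aszP; rewrite enc_automatonE /=; lia.
pose Inv (don : seq tree) v := enc_bool (all check (take (size don) L)) = v.
rewrite -[x]spineK -(take_size L) -szx.
apply: (loop_spec (Inv := Inv)) => //.
- move=> don y rest acc def <- accB.
  have yx : y \in spine x by rewrite -def mem_cat mem_head orbT.
  have yB : tree_size y < xsz := leq_trans (spine_size yx) xB.
  have ltd : size don < size L by rewrite -szx -def size_cat /=; lia.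
  pose l := nth (0, fset0) L (size don).
  have lL : l \in L by apply: mem_nth.
  have [hdy tly] : hd y = enc_nat l.1 /\ codes_set l.2 (tl y).
    have: nth Leaf (spine x) (size don) = y by rewrite -def nth_cat ltnn subnn.
    rewrite /l; elim: rep (size don) ltd => [|l' z L0 zs lz _ IH] [|n] //=.
      by move=> _ <-.
    exact: IH.
  have := tree_size_tl y; have := tree_size_hd y => szh szt.
  have [ltl leS leb] := sound_bounds (soundL l lL).
  have witl : {subset l.2 <= wit C k}.
    by have [tau [Stau _ ->]] := soundL l lL; apply: dyn_wit.
  have takeE : take (size (rcons don y)) L = rcons (take (size don) L) l.
    by rewrite size_rcons (take_nth (0, fset0)).
  rewrite /Inv takeE all_rcons.
  have chk : check l = (l.1 \in finals A) ==> has (fin C k) (enum_fset l.2) by [].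
  have memE : (hd y \in spine final) = (l.1 \in finals A).
    by rewrite hdy /final enc_seqE lstK (mem_map enc_nat_inj).
  rewrite /=; case: (all _ (take _ _)) => /=; last first.
    by rewrite andbF; split=> //; rewrite /Tcall; lia.
  rewrite andbT; do 2!eexists; split; first by apply: (mem_spec _ B_ge4); lia.
  move=> _ <-; rewrite memE chk.
  case: (l.1 \in finals A) => /=; last by split=> //; rewrite /Tcall; lia.
  do 2!eexists; split; first by apply: final_spec witl leb tly _; lia.
  by move=> _ <-; split=> //; rewrite /Tcall; lia.
- by move=> don _ acc _ <-; have := tree_size_bool (all check (take (size don) L)); lia.
- by rewrite /=; lia.
- by rewrite spineK; lia.
- by rewrite /Inv take0.
Qed.

(** Completeness of the saturation, by induction on the term: the last transition of a run is
    applied to pairs already in [L]. Soundness is built into [valid]. *)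
Lemma closed_complete L tau q : closed_under L L -> q \in reached A tau ->
  (q, dyn C k tau) \in L.
Proof.
move=> closedL; elim/term_all_ind: tau q => a ts IHts q /reachedP[d [dA <- <- dts]].
rewrite [dyn _ _ _]/=; apply: closedL => //.
elim: ts (d.1.2) IHts dts => [|t ts IH] [|p ps] //= IHts /andP[pt pts].
rewrite IHts ?IH //; last by left.
by move=> t' t'ts; apply: IHts; right.
Qed.

Lemma main_spec : routine_ok RAutomaton K (eq (enc_automaton A)) ->
  fspec 0 K (fun v => exists2 b : bool, v = enc_bool b &
      b <-> forall tau, recognizes A tau -> accepted C k tau)
    (Tcall (Tcheck B + Tfix B + B) B).
Proof.
move=> autA_ok.
have [transB finB] : tree_size trans <= asz /\ tree_size final <= asz.
  by move: aszP; rewrite enc_automatonE /=; lia.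
have v0 : valid [::] Leaf by split=> //; constructor.
apply: wp_spec => /=; do 2!eexists; split; first exact: autA_ok.
move=> _ <-; rewrite enc_automatonE /=.
do 2!eexists; split; first exact: fix_spec v0.
move=> x [L vLx closedL].
do 2!eexists; split; first exact: check_spec vLx.
have [szL szx xB] := valid_size vLx; have [rep uL soundL] := vLx.
move=> _ <-; split; last first.
  (* The number of rounds is thereby bounded by [B], so that the total time depends on [B] alone. *)
  have leNB : N < B.
    have: N * 1 <= N * (asz + sz + 2) by rewrite leq_mul //; lia.
    by lia.
  have := leq_mul leNB (leqnn (Tcall (Tround B + Teq B) B)).
  by rewrite subn0 [Tcall (_ + _ + B) B]/Tcall /Tfix mulSn; lia.
exists (all check L) => //; split=> [/allP chk tau /hasP[q qtau qA]|acc].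
  have := chk _ (closed_complete closedL qtau); rewrite /check qA /=.
  by case/hasP=> w wt fw; exists w.
apply/allP => l /soundL[tau [_ ltau lE]]; apply/implyP => lA.
have [|w wt fw] := acc tau; first by apply/hasP; exists l.1.
by apply/hasP; exists w; rewrite // lE.
Qed.

End Algorithm.

(** * Polynomial bounds *)

(** Only pairing creates new data, and it pays for the whole result. This turns the time bounds of
    the routines into size bounds for their outputs. *)
Lemma eval_size (p : program void) rho e v t m :
  eval no_ext p rho e v t -> 0 < m -> (forall x, x \in rho -> tree_size x <= m) ->
  tree_size v <= maxn m t.
Proof.
move=> ev; elim: ev m => {rho e v t} //=.
- move=> rho i m m_gt0 rhom; rewrite leq_max; apply/orP; left.
  case: (ltnP i (size rho)) => lei; first by apply: rhom; apply: mem_nth.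
  by rewrite nth_default.
- by move=> rho m; lia.
- by move=> *; lia.
- move=> rho e v t _ IH m m_gt0 rhom; have := IH m m_gt0 rhom.
  by have := tree_size_hd v; lia.
- move=> rho e v t _ IH m m_gt0 rhom; have := IH m m_gt0 rhom.
  by have := tree_size_tl v; lia.
- move=> rho e e1 e2 v1 v2 v t t' _ _ _ IH m m_gt0 rhom.
  by have := IH m m_gt0 rhom; lia.
- move=> rho e e1 e2 v t t' _ _ _ IH m m_gt0 rhom.
  by have := IH m m_gt0 rhom; lia.
- move=> rho e1 e2 v1 v t t' _ IH1 _ IH m m_gt0 rhom.
  have le1 := IH1 m m_gt0 rhom.
  have: tree_size v <= maxn (maxn m t) t'.
    apply: IH; first by lia.
    by move=> x; rewrite inE => /predU1P[->|/rhom] //; lia.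
  by lia.
- move=> rho i e1 v1 v t t' _ IH1 _ IH m m_gt0 rhom.
  have le1 := IH1 m m_gt0 rhom.
  have: tree_size v <= maxn (maxn m t) t'.
    by apply: IH; first lia; move=> x; rewrite inE => /eqP->.
  by lia.
Qed.

Lemma runs_size (p : program void) x v t :
  runs no_ext p x v t -> tree_size v <= maxn (tree_size x) t.
Proof.
move=> ev; apply: eval_size ev (tree_size_gt0 x) _.
by move=> y; rewrite inE => /eqP->.
Qed.

Lemma leq_poly c m n : m <= n -> poly c m <= poly c n.
Proof. by case: c => [|c] le //; rewrite /poly leq_add2r leq_mul2l leq_exp2r ?le. Qed.

(** For [1 < m] constants and sums are absorbed by the exponent, so a pure power suffices; a pure
    power of [M] splits into powers of its factors. *)
Definition polybounded (g : nat -> nat) := exists e, forall m, 1 < m -> g m <= m ^ e.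

Lemma polybounded_const n : polybounded (fun=> n).
Proof.
exists n => m m_gt1; apply: ltnW; exact: ltn_expl.
Qed.

Lemma polybounded_id : polybounded (fun m => m).
Proof. by exists 1 => m _; rewrite expn1. Qed.

Lemma polybounded_mul g h : polybounded g -> polybounded h ->
  polybounded (fun m => g m * h m).
Proof.
move=> [e ge] [e' he]; exists (e + e') => m m_gt1.
by rewrite expnD leq_mul ?ge ?he.
Qed.

Lemma polybounded_add g h : polybounded g -> polybounded h ->
  polybounded (fun m => g m + h m).
Proof.
move=> [e ge] [e' he]; exists (e + e').+1 => m m_gt1.
have m_gt0 : 0 < m by lia.
apply: (@leq_trans (2 * m ^ (e + e'))); last by rewrite expnS leq_mul2r m_gt1 orbT.
have := ge m m_gt1; have := he m m_gt1.
have: m ^ e <= m ^ (e + e') by rewrite leq_pexp2l // leq_addr.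
have: m ^ e' <= m ^ (e + e') by rewrite leq_pexp2l // leq_addl.
by lia.
Qed.

Lemma polybounded_exp g n : polybounded g -> polybounded (fun m => g m ^ n).
Proof.
move=> [e ge]; exists (e * n) => m m_gt1; rewrite expnM.
by case: n => // n; rewrite leq_exp2r // ge.
Qed.

Lemma polybounded_S g : polybounded g -> polybounded (fun m => (g m).+1).
Proof.
move=> pg; have [e ge] := polybounded_add pg (polybounded_const 1).
by exists e => m /ge; rewrite addn1.
Qed.

Lemma polybounded_poly c g : polybounded g -> polybounded (fun m => poly c (g m)).
Proof.
move=> pg; exact: polybounded_add (polybounded_mul (polybounded_const c)
  (polybounded_exp c pg)) (polybounded_const c).
Qed.

Lemma polybounded_Tcall T g : polybounded T -> polybounded g ->
  polybounded (fun m => Tcall (T m) (g m)).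
Proof.
move=> pT pg; refine (polybounded_add (polybounded_add pT _) (polybounded_const _)).
exact: polybounded_mul (polybounded_const 30) pg.
Qed.

Lemma polybounded_Tloop T g : polybounded T -> polybounded g ->
  polybounded (fun m => Tloop (T m) (g m)).
Proof.
move=> pT pg; refine (polybounded_mul (polybounded_S pg) _).
refine (polybounded_add (polybounded_add pT _) (polybounded_const _)).
exact: polybounded_mul (polybounded_const 6) pg.
Qed.

(* Selects the closure rule syntactically, as unification would unfold the
   arithmetic operations. *)
Ltac polybounded := repeat lazymatch goal with
  | pg : polybounded ?g |- polybounded (fun m => ?g m) => exact: pg
  | |- polybounded (fun m => m) => exact: polybounded_id
  | |- polybounded (fun m => (@?g m) + (@?h m)) =>
      refine (@polybounded_add g h _ _)
  | |- polybounded (fun m => (@?g m) * (@?h m)) =>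
      refine (@polybounded_mul g h _ _)
  | |- polybounded (fun m => (@?g m) ^ ?n) => refine (@polybounded_exp g n _)
  | |- polybounded (fun m => poly ?c (@?g m)) => refine (@polybounded_poly c g _)
  | |- polybounded (fun m => Tcall (@?T m) (@?g m)) =>
      refine (@polybounded_Tcall T g _ _)
  | |- polybounded (fun m => Tloop (@?T m) (@?g m)) =>
      refine (@polybounded_Tloop T g _ _)
  | |- _ => first [exact: polybounded_const | refine (polybounded_S _)]
  end.

Definition Tmain B := Tcall (Tcheck B + Tfix B + B) B.

Lemma polybounded_Tmain g : polybounded g -> polybounded (fun m => Tmain (g m)).
Proof.
move=> pg.
rewrite /Tmain /Tcheck /Tfix /Tfinal /Tround /Ttuples /Tset /Tstep /Tinsert /TmemX
  /Tfilters /Tfilter /Tchoices /Textend /Trev /Tunion /Tseteq /Tsub /Tmem /Teq.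
by polybounded.
Qed.

Lemma leq_expl m : m <= 2 ^ m.
Proof. exact: ltnW (ltn_expl m (ltnSn 1)). Qed.

(** A set of at most [mu] strings is a word of length [mu], padded by [None], over the strings of
    length at most [be]. There are fewer than [2 ^ be.+1] such strings, so the alphabet including
    [None] has at most that many letters. *)
Lemma states_bound F mu be (L : seq (nat * {fset witness})) : uniq L ->
  (forall l, l \in L -> [/\ l.1 < F, #|` l.2| <= mu &
     forall w, w \in l.2 -> size w <= be]) ->
  size L <= F * 2 ^ (be.+1 * mu).
Proof.
move=> uL LP.
pose ws := words (None :: map Some (strings be)) mu.
pose all_states := [seq (q, [fset w in pmap id w']%fset) | q <- iota 0 F, w' <- ws].
apply: (@leq_trans (size all_states)).
  apply: uniq_leq_size uL _ => -[q S] /LP[/= ltq leS leb].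
  apply/allpairsP; exists (q, map Some (enum_fset S) ++ nseq (mu - #|` S|) None).
  split=> /=; first by rewrite mem_iota.
    rewrite mem_words size_cat size_map size_nseq subnKC // eqxx /=.
    rewrite all_cat all_map; apply/andP; split.
      apply/allP => w Sw; change (Some w \in None :: map Some (strings be)).
      by rewrite inE map_f // mem_strings // leb.
    by apply/allP => w; rewrite mem_nseq => /andP[_ /eqP->].
  congr (_, _); apply/fsetP => w; rewrite inE pmap_cat mem_cat /=.
  rewrite (_ : pmap id (nseq _ _) = [::]) ?orbF; last by elim: (_ - _).
  by rewrite map_pK.
rewrite size_allpairs size_iota size_words leq_mul2l expnM; apply/orP; right.
case: (mu) => // m; rewrite leq_exp2r //= size_map; exact: size_strings.
Qed.

(** * All data are polynomial in one quantity *)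

Section Bounds.
Variable c0 : nat.

(* Bounds in terms of m = (k + 2) f(k)^r 2^(r beta mu) for the sizes of the data
   of the algorithm; m ^ 3 bounds the number of tuples of pairs. *)
Definition automaton_bound m := poly c0 m * m ^ c0 + 2 * m + 1.
Definition input_bound m := 2 * m + automaton_bound m + m * (4 * m + 2) + m * m + 10.
Definition step_bound m := poly c0 (input_bound m) + input_bound m.
Definition set_bound m := m * (4 * m + 2) + 1.
Definition states_size_bound m := m ^ 3 * (automaton_bound m + set_bound m + 2) + 1.
Definition set_choices_bound m := m ^ 3 * (m * (set_bound m).+1 + 2) + 3.
Definition choices_bound m := m * (m * (4 * m + 1).+1 + 2) + 3.
Definition union_bound m := (m + 1) * step_bound m + 3.
Definition size_bound m := 2 * m + 3 * automaton_bound m + set_bound m +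
  states_size_bound m + 30 + (m * (states_size_bound m).+1 + 1) +
  set_choices_bound m + choices_bound m + union_bound m +
  poly c0 (input_bound m) + poly c0 (2 * m + union_bound m).

Lemma polybounded_size_bound : polybounded size_bound.
Proof.
rewrite /size_bound /union_bound /choices_bound /set_choices_bound
  /states_size_bound /step_bound /set_bound /input_bound /automaton_bound.
by polybounded.
Qed.

Lemma main_size_bound (r : nat) (D : decomposition_class r) (f : nat -> nat)
    (C : dp_core) (impl : routine -> program void) k :
  has_complexity c0 D f (impl RAutomaton) -> finite_core C ->
  internally_polynomial c0 C impl -> coherent D C ->
  exists2 b : bool, b <-> included D C k &
    computes (link impl) inclusion_program (enc_nat k) (eq (enc_bool b))
      (Tmain (size_bound ((k + 2) * pos (f k) ^ pos r *
        2 ^ (pos r * pos (betaK C k) * pos (muK C k))))).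
Proof.
move=> compl finC [_ [_ base_ok step_ok fin_ok clean_inv_ok]] coh.
have [alphaE _] := coh.
have [A [[autA langA] leA [_ [t [<- let' runA]]]]] := compl k.
set F := pos (f k); set R := pos r; set b := pos (betaK C k).
set mu := pos (muK C k); set be := betaK C k.
have F_gt0 : 0 < F by rewrite /F /pos leq_max.
have R_gt0 : 0 < R by rewrite /R /pos leq_max.
have b_gt0 : 0 < b by rewrite /b /pos leq_max.
have mu_gt0 : 0 < mu by rewrite /mu /pos leq_max.
have beb : be <= b by rewrite /b /pos leq_max leqnn orbT.
set X := 2 ^ (R * b * mu); set M := (k + 2) * F ^ R * X.
have X_gt0 : 0 < X by rewrite expn_gt0.
have FR_gt0 : 0 < F ^ R by rewrite expn_gt0 F_gt0.
have XM : X <= M by rewrite /M leq_pmull // muln_gt0 FR_gt0 addn2.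
have FXM : F ^ R * X <= M by rewrite /M -mulnA leq_pmull // addn2.
have FRM : F ^ R <= M by apply: leq_trans FXM; rewrite leq_pmulr.
have kM : k + 2 <= M by rewrite /M -mulnA leq_pmulr // muln_gt0 FR_gt0.
(* Each of [R], [mu] and [be] is at most [R * b * mu], and [n <= 2 ^ n] then puts it below [M]. *)
have leX n : n <= R * b * mu -> 2 ^ n <= M.
  by move=> le; apply: leq_trans XM; rewrite leq_exp2l.
have RM : R <= M.
  by apply: leq_trans (leq_expl R) (leX _ _); rewrite -mulnA leq_pmulr // muln_gt0 b_gt0.
have muM : mu <= M.
  by apply: leq_trans (leq_expl mu) (leX _ _); rewrite leq_pmull // muln_gt0 R_gt0.
have beM : be <= M.
  apply: leq_trans (leq_expl be) (leX _ _); apply: leq_trans beb _.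
  by rewrite mulnAC leq_pmull // muln_gt0 R_gt0.
have muRM : mu ^ R <= M.
  apply: (@leq_trans ((2 ^ mu) ^ R)); first by rewrite leq_exp2r // leq_expl.
  by rewrite -expnM; apply: leX; rewrite mulnC leq_mul2r leq_pmulr ?orbT.
pose N := F * 2 ^ (be.+1 * mu).
have N_gt0 : 0 < N by rewrite muln_gt0 F_gt0 expn_gt0.
(* As [be.+1 <= 2 * b], the power of two in [N ^ R] is at most [X * X], while [F ^ R * X <= M] and
   [X <= M]. *)
have NRM : N ^ R <= M ^ 3.
  rewrite /N expnMn -expnM.
  apply: (@leq_trans (F ^ R * (X * X))).
    rewrite leq_mul2l -expnD leq_exp2l //; apply/orP; right.
    have: be.+1 * (mu * R) <= (2 * b) * (mu * R) by rewrite leq_mul2r; lia.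
    by rewrite mulnA; lia.
  by rewrite mulnA !expnS expn0 muln1 leq_mul // -[X in X <= _]mul1n leq_mul //; lia.
have NM : N <= M ^ 3 by apply: leq_trans NRM; rewrite -[X in X <= _]expn1 leq_pexp2l.
(* [F ^ (c0 * R)] is the [c0]-th power of [F ^ R], which is at most [M]. *)
have autM : poly c0 k * F ^ (c0 * R) <= poly c0 M * M ^ c0.
  apply: leq_mul; first by apply: leq_poly; lia.
  by rewrite mulnC expnM; case: (c0) => // c; rewrite leq_exp2r.
have aszP : tree_size (enc_automaton A) <= automaton_bound M.
  have := runs_size runA; rewrite tree_size_enc_nat /automaton_bound.
  by have := leq_trans let' autM; lia.
have szle : mu * (4 * be + 2) + 1 <= set_bound M.
  by rewrite /set_bound leq_add2r leq_mul //; lia.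
have xszle : N * (automaton_bound M + (mu * (4 * be + 2) + 1) + 2) + 1 <=
    states_size_bound M.
  by rewrite /states_size_bound leq_add2r leq_mul //; lia.
have chle : N ^ R * (R * (mu * (4 * be + 2) + 1).+1 + 2) + 3 <= set_choices_bound M.
  by rewrite /set_choices_bound leq_add2r leq_mul // leq_add2r leq_mul // ltnS.
have chle' : mu ^ R * (R * (4 * be + 1).+1 + 2) + 3 <= choices_bound M.
  by rewrite /choices_bound leq_add2r leq_mul // leq_add2r leq_mul //; lia.
have unle : (mu ^ R + 1) * step_bound M + 3 <= union_bound M.
  by rewrite /union_bound leq_add2r leq_mul // leq_add2r.
have poly_input n : n <= input_bound M -> poly c0 n <= size_bound M.
  by move/(leq_poly c0); rewrite /size_bound; lia.
have dynP tau : term_over (core_alphabet C k) tau ->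
    #|` dyn C k tau| <= mu /\ forall w, w \in dyn C k tau -> size w <= be.
  move/(dyn_size finC) => [le1 le2]; split=> //.
  by apply: leq_trans le1 _; rewrite /mu /pos leq_max leqnn orbT.
rewrite -alphaE in autA.
have witP q x out T : computes no_ext (impl q) x out T -> T <= size_bound M ->
    routine_ok impl (size_bound M) q x out.
  by case=> y [u [outy leu ev]] leT; exists y, u; split;
    [exact: outy | exact: leq_trans leu leT | exact: ev].
have K_size : tree_size (enc_nat k) = 2 * k + 1 by apply: tree_size_enc_nat.
have nodeK x : tree_size (Node (enc_nat k) x) = (2 * k + 1 + tree_size x).+1.
  by rewrite -K_size.
have arityR a : a \in core_alphabet C k -> arity a <= R.
  rewrite alphaE => /alphabet_arity lea.
  by apply: leq_trans lea _; rewrite /R /pos leq_max leqnn orbT.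
suff: fspec (link impl) inclusion_program 0 (enc_nat k)
  (fun v => exists2 b' : bool, v = enc_bool b' &
     b' <-> forall tau, recognizes A tau -> accepted C k tau)
  (Tmain (size_bound M)).
  case=> v [u [ev [b' vE b'P] leu]]; exists b'; last first.
    by exists v, u; split; [rewrite vE | exact: leu | exact: ev].
  rewrite b'P (includedE coh); split=> acc tau.
    by move/langA; apply: acc.
  by move=> /langA; apply: acc.
apply: (@main_spec C k A impl autA mu be N R (step_bound M) (automaton_bound M)) => //.
- by rewrite /size_bound; lia.
- have: R * (N * (automaton_bound M + (mu * (4 * be + 2) + 1) + 2) + 1).+1 <=
      M * (states_size_bound M).+1 by rewrite leq_mul // ltnS.
  by rewrite /size_bound; lia.
- by apply: leq_trans chle _; rewrite /size_bound; lia.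
- by apply: leq_trans chle' _; rewrite /size_bound; lia.
- by apply: leq_trans unle _; rewrite /size_bound; lia.
- move=> L uL LP; apply: states_bound uL _ => l /LP[ltl leS leb]; split=> //.
  apply: leq_trans ltl _; apply: leq_trans leA _.
  by rewrite /F /pos leq_max leqnn orbT.
- move=> a Sa a0 sza; apply: witP (base_ok k a Sa a0) _.
  apply: poly_input.
  (* The summand [m * m] of [input_bound] accounts for the product of the two measures in the budget
     of [RBase]. *)
  have leb1 : beta C k 1 <= M by apply: leq_trans (beta_betaK finC k 1) beM.
  have lem1 : Defs.mu C k 1 <= M.
    apply: leq_trans (mu_muK finC k 1) (leq_trans _ muM).
    by rewrite /mu /pos leq_max leqnn orbT.
  have := leq_mul leb1 lem1; rewrite /input_bound nodeK; lia.
- move=> a ws Sa a_gt0 sza szws witws leb.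
  have szx : tree_size (Node (enc_nat k) (Node (enc_symbol a) (enc_seq enc_str ws)))
      <= input_bound M.
    have szs : tree_size (enc_seq enc_str ws) <= R * (4 * be + 2) + 1.
      rewrite enc_seqE; apply: leq_trans (tree_size_lst (m := 4 * be + 1) _) _.
        move=> _ /mapP[w wws ->]; apply: leq_trans (tree_size_enc_str w) _.
        by rewrite leq_add2r leq_mul2l (allP leb).
      by rewrite leq_add2r size_map szws -addnS leq_mul // arityR.
    have: R * (4 * be + 2) <= M * (4 * M + 2) by apply: leq_mul => //; lia.
    have nodeE x y : tree_size (Node x y) = (tree_size x + tree_size y).+1 by [].
    by rewrite nodeK (nodeE (enc_symbol a)) /input_bound; lia.
  have [y [u [outy leu ev]]] := step_ok k a ws Sa a_gt0 szws witws.
  exists y, u; split=> //; last by apply: leq_trans leu _; apply: poly_input.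
  split=> //; apply: leq_trans (runs_size ev) _.
  by rewrite /step_bound; have := leq_poly c0 szx; lia.
- move=> S x witS Sx szx; have [clean_ok _] := clean_inv_ok k S x witS Sx.
  apply: witP clean_ok _; rewrite /size_bound.
  have: poly c0 (tree_size (Node (enc_nat k) x)) <= poly c0 (2 * M + union_bound M).
    by apply: leq_poly; rewrite nodeK; lia.
  by lia.
- move=> w witw lew; apply: witP (fin_ok k w witw) _; apply: poly_input.
  have: tree_size (enc_str w) <= 4 * be + 1.
    by apply: leq_trans (tree_size_enc_str w) _; rewrite leq_add2r leq_mul2l lew.
  have: 1 * (4 * be + 2) <= M * (4 * M + 2) by apply: leq_mul; lia.
  by rewrite nodeK /input_bound; lia.
- exists (enc_automaton A), t; split=> //; apply: leq_trans let' _.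
  by rewrite -/F -/R; apply: leq_trans autM _; rewrite /size_bound /automaton_bound; lia.
Qed.

End Bounds.

(** The exponent [e] comes from a polynomial expression in [M] that involves [c0] only; hence the
    constant is uniform in the class, the core and the routines. *)
Lemma decides_inclusion_program c0 : exists c : nat,
  forall (r : nat) (D : decomposition_class r) (f : nat -> nat) (C : dp_core)
    (impl : routine -> program void),
  has_complexity c0 D f (impl RAutomaton) -> finite_core C ->
  internally_polynomial c0 C impl -> coherent D C ->
  decides (link impl) inclusion_program (included D C)
    (fun k => poly c k * time_bound c r f C k).
Proof.
have [e eP] := polybounded_Tmain (polybounded_size_bound c0).
(* The factor [(k + 2) ^ e] must fit into [poly c k]: for [k < 2] it is at most [3 ^ e], covered by
   the additive constant, and otherwise [k + 2 <= 2 * k] gives [2 ^ e * k ^ e]. *)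
exists (4 ^ e) => r D f C impl compl finC polyC coh k.
have [b binc [v [t [outv let' ev]]]] := main_size_bound k compl finC polyC coh.
exists b => //; exists v, t; split=> //; apply: leq_trans let' _.
set F := pos (f k); set x := pos r * _ * _; set M := _ * _ * _.
have F_gt0 : 0 < F by rewrite /F /pos leq_max.
have FR_gt0 : 0 < F ^ pos r by rewrite expn_gt0 F_gt0.
(* The summand [2] in [k + 2] secures this even for [k = 0]. *)
have M_gt1 : 1 < M.
  rewrite /M -mulnA; apply: leq_trans (leq_pmulr _ _);
    by rewrite ?muln_gt0 ?FR_gt0 ?expn_gt0 //; lia.
apply: leq_trans (eP M M_gt1) _.
have lee : e <= 4 ^ e by apply: ltnW; apply: ltn_expl.
rewrite /M !expnMn -mulnA -!expnM /time_bound -/F -/x; apply: leq_mul.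
  rewrite /poly; case: (k) => [|[|n]].
  - by apply: leq_trans (leq_addl _ _); rewrite add0n; case: (e) => // m; rewrite leq_exp2r.
  - by apply: leq_trans (leq_addl _ _); case: (e) => // m; rewrite leq_exp2r.
  apply: leq_trans (leq_addr _ _).
  apply: (@leq_trans ((2 * n.+2) ^ e)).
    by case: (e) => // m; rewrite leq_exp2r //; lia.
  rewrite expnMn leq_mul ?leq_pexp2l //.
  by case: (e) => // m; rewrite leq_exp2r.
apply: leq_mul; first by rewrite leq_pexp2l // mulnC leq_mul2r lee orbT.
by rewrite leq_exp2l // mulnC leq_mul2r lee orbT.
Qed.

Theorem theorem6 :
  exists P : program routine,
  forall c0 : nat, exists c : nat,
  forall (r : nat) (D : decomposition_class r) (f : nat -> nat) (C : dp_core)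
         (impl : routine -> program void),
    has_complexity c0 D f (impl RAutomaton) ->
    finite_core C ->
    internally_polynomial c0 C impl ->
    coherent D C ->
    [/\ decides (link impl) P (included D C)
          (fun k => poly c k * time_bound c r f C k),
        exists (Q : program void) (c1 : nat),
          decides no_ext Q (included D C) (time_bound c1 r f C) &
        forall a : nat, exists b : nat, forall k : nat,
          time_bound a r f C k <= coarse_bound b r f C k].
Proof.
exists inclusion_program => c0; have [c cP] := decides_inclusion_program c0; exists c.
move=> r D f C impl compl finC polyC coh; split.
- exact: cP.
- exact: decides_included.
- by move=> a; apply: time_bound_coarse.
Qed.
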